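(* Let $\sigma=\mathrm{ReLU}$, i.e. $\sigma(x)=\max(0,x)$, and consider the covariance sequence $\{\Sigma^{(L)}\}_{L\ge1}$ and the metrics $\mathrm{FSP}_L(\sigma_w^2)$, $\mathrm{GEV}_L(\sigma_w^2)$ defined in the context. Then: 1. If $\sigma_w^2=2$, then either $\lim_{L\to\infty}\mathrm{GEV}_L(\sigma_w^2)=0$ or $\lim_{L\to\infty}\mathrm{FSP}_L(\sigma_w^2)=0$. 2. If $0<\sigma_w^2<2$, then for every $L\ge1$, $\mathrm{FSP}_L(\sigma_w^2)\le \frac{2C}{d_0}\left(\frac{\sigma_w^2}{2}\right)^L$.
   Context: Let $\mathcal G=(\mathcal V,\mathcal E)$ be a finite undirected graph with $n$ nodes, adjacency matrix $A\in\{0,1\}^{n\times n}$, degree matrix $D=\mathrm{diag}(A\mathbf 1_n)$ with degrees $d_i$, $\tilde A=A+I$, $\tilde D=D+I$, normalized adjacency $\hat A=\tilde D^{-1/2}\tilde A\tilde D^{-1/2}$ and normalized Laplacian $\hat L=I-\hat A$. For $H\in\mathbb R^{n\times C}$ with rows $h_i$, the Dirichlet energy is $\mathrm{Dir}(H)=\mathrm{tr}(H^\top\hat LH)=\sum_{\{i,j\}\in\mathcal E}\|h_i/\sqrt{1+d_i}-h_j/\sqrt{1+d_j}\|^2$. Let $X\in\mathbb R^{n\times d_0}$ be a nonzero feature matrix, $C\ge1$ an integer (number of output channels), $\sigma:\mathbb R\to\mathbb R$ an activation function applied entrywise, and $\sigma_w^2>0$. For a positive semidefinite $\Sigma\in\mathbb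 R^{n\times n}$ set $G(\Sigma)=\mathbb E_{h\sim N(\mathbf 0_n,\Sigma)}[\sigma(h)\sigma(h)^\top]$. Define $\Sigma^{(1)}=\frac{\sigma_w^2}{d_0}\hat AXX^\top\hat A$ and $\Sigma^{(l+1)}=\sigma_w^2\hat AG(\Sigma^{(l)})\hat A$ for $l\ge1$ (the infinite-width NNGP covariances of a vanilla GCN $H^{(l)}=\hat A\sigma(H^{(l-1)})W^{(l)}$ with i.i.d. weights of variance $\sigma_w^2/\text{fan-in}$ and zero biases). With $H\in\mathbb R^{n\times C}$ having i.i.d. columns distributed as $N(\mathbf 0_n,\Sigma^{(L)})$, define the forward signal propagation metric $\mathrm{FSP}_L(\sigma_w^2)=\mathbb E[\|H\|_F^2/\|X\|_F^2]$ and the graph embedding variation metric $\mathrm{GEV}_L(\sigma_w^2)=\mathbb E[\mathrm{Dir}(H)/\|H\|_F^2]$. *)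

(* Defs.v *)
From HB Require Import structures.
From mathcomp Require Import all_boot all_order all_algebra.
From mathcomp Require Import all_classical all_reals all_analysis.
Set Implicit Arguments. Unset Strict Implicit. Unset Printing Implicit Defensive.
Import Order.TTheory GRing.Theory Num.Theory.
Local Open Scope classical_set_scope.
Local Open Scope ring_scope.

Section GCN.
Context {R : realType}.

Definition relu (x : R) : R := Num.max x 0.

(* E over z = (z_1,...,z_m) i.i.d. N(0,1) of f z, as an iterated integral
   (nonnegative integrands only, values in \bar R). *)
Fixpoint std_gauss_iter (m : nat) (f : seq R -> \bar R) : \bar R :=
  match m with
  | 0 => f [::]
  | m'.+1 => (\int[normal_prob 0 1]_x std_gauss_iter m' (fun s => f (x :: s)))%E
  end.

Definition cov_factor (n : nat) (S : 'M[R]_n) : 'M[R]_n :=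
  xget 0 [set B : 'M[R]_n | B *m B^T = S].

(* E_{H}[f H], where H in R^{n x C} has i.i.d. columns ~ N(0, S):
   H = B Z with B B^T = S and Z an n x C matrix of i.i.d. N(0,1). *)
Definition gauss_mx_exp (n C : nat) (S : 'M[R]_n) (f : 'M[R]_(n, C) -> \bar R)
  : \bar R :=
  std_gauss_iter (n * C)
    (fun s => f (cov_factor S *m \matrix_(i < n, j < C) nth 0 s (i + n * j))).

Definition Gmat (n : nat) (S : 'M[R]_n) : 'M[R]_n :=
  \matrix_(i, j) fine (gauss_mx_exp (C := 1) S
                     (fun H => (relu (H i ord0) * relu (H j ord0))%:E)).

(* graph given by a symmetric irreflexive relation e on 'I_n *)
Definition adj (n : nat) (e : rel 'I_n) : 'M[R]_n := \matrix_(i, j) (e i j)%:R.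
Definition deg (n : nat) (e : rel 'I_n) (i : 'I_n) : R := \sum_j adj e i j.

(* normalized adjacency  D~^{-1/2} (A + I) D~^{-1/2} *)
Definition Ahat (n : nat) (e : rel 'I_n) : 'M[R]_n :=
  \matrix_(i, j) ((adj e + 1%:M) i j /
                  (Num.sqrt (1 + deg e i) * Num.sqrt (1 + deg e j))).

Definition Lhat (n : nat) (e : rel 'I_n) : 'M[R]_n := 1%:M - Ahat e.

Definition dirichlet (n C : nat) (e : rel 'I_n) (H : 'M[R]_(n, C)) : R :=
  \tr (H^T *m Lhat e *m H).

Definition frob2 (m k : nat) (M : 'M[R]_(m, k)) : R := \sum_i \sum_j M i j ^+ 2.

(* NNGP covariances: Sigma 1 = sw2/d0 Ahat X X^T Ahat,
   Sigma (l+1) = sw2 Ahat G(Sigma l) Ahat; Sigma 0 is an unused dummy. *)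
Fixpoint Sigma (n d0 : nat) (e : rel 'I_n) (X : 'M[R]_(n, d0)) (sw2 : R)
  (l : nat) : 'M[R]_n :=
  match l with
  | 0 => 0
  | 1 => (sw2 / d0%:R) *: (Ahat e *m X *m X^T *m Ahat e)
  | l'.+1 => sw2 *: (Ahat e *m Gmat (Sigma e X sw2 l') *m Ahat e)
  end.

Definition FSP (n d0 : nat) (e : rel 'I_n) (X : 'M[R]_(n, d0)) (C : nat)
  (sw2 : R) (L : nat) : \bar R :=
  gauss_mx_exp (C := C) (Sigma e X sw2 L) (fun H => (frob2 H / frob2 X)%:E).

Definition GEV (n d0 : nat) (e : rel 'I_n) (X : 'M[R]_(n, d0)) (C : nat)
  (sw2 : R) (L : nat) : \bar R :=
  gauss_mx_exp (C := C) (Sigma e X sw2 L) (fun H => (dirichlet e H / frob2 H)%:E).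

End GCN.

(* Main.v *)
(* Put M = I - Ahat = P^T P. Because of the self-loops the eigenvalues of M lie in
   [0, 2 - 2/(n+1)], so that ||Ahat Y||^2 <= ||Y||^2 and the Dirichlet energy of
   Ahat Y is at most a constant times the loss ||Y||^2 - ||Ahat Y||^2. Since
   tr G(S) = tr S / 2 by the symmetry h -> -h, one layer multiplies tr Sigma by at
   most sw2 / 2, which gives the bound on FSP. For sw2 = 2 the trace decreases to
   some t. If t = 0 then FSP tends to 0. If t > 0, the loss of trace tends to 0,
   hence so does E[Dir(H)]; moreover some entry h of H has variance bounded below,
   and E[Dir(H)/||H||^2] <= 2 P(h^2 < r) + E[Dir(H)]/r with P(h^2 < r) = O(sqrt r). *)

(* In an eigenmode of M with eigenvalue m, one propagation loses m (2 - m) of the squared norm and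
   leaves Dirichlet energy m (1 - m)^2. The loss controls the energy only if m stays away from 2:
   there Ahat would act as -1, keeping the norm together with maximal energy, and this is what the
   self-loops exclude. No diagonalization is used; the factor P replaces it, at the price of a
   cruder constant. GEV is the expectation of a quotient, so a small expected energy is not enough:
   H must rarely be close to 0. One Gaussian entry settles this, because its density is bounded. The
   threshold r is the square root of a bound on the energy, which makes both error terms vanish in
   the limit. [cov_factor] picks an unspecified factor, so every estimate has to hold for any
   factor: the norms [frob2 (P *m cov_factor S)] depend on S alone, and the large entry is found
   from the norm only. Integrals are iterated and of nonnegative functions only, so signed
   expressions are first split or symmetrized. *)
Require Import Defs.
From HB Require Import structures.
From mathcomp Require Import all_boot all_order all_algebra.
From mathcomp Require Import all_classical all_reals all_analysis.
From mathcomp Require Import measurable_realfun ring lra.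
Set Implicit Arguments. Unset Strict Implicit. Unset Printing Implicit Defensive.
Import Order.TTheory GRing.Theory Num.Theory numFieldNormedType.Exports.
Local Open Scope classical_set_scope.
Local Open Scope ring_scope.

(** * Positive semidefinite matrices and the normalized adjacency *)

Section MatrixEntries.
Context {V : zmodType} {m k : nat}.
Implicit Types (A B : 'M[V]_(m, k)).

Lemma addmxE A B i j : (A + B) i j = A i j + B i j.
Proof. by rewrite mxE. Qed.

Lemma oppmxE A i j : (- A) i j = - A i j.
Proof. by rewrite mxE. Qed.

End MatrixEntries.

Lemma scalemxE {R : pzRingType} m k a (A : 'M[R]_(m, k)) i j :
  (a *: A) i j = a * A i j.
Proof. by rewrite mxE. Qed.

Section Psd.
Context {R : realType}.

Definition psd n (S : 'M[R]_n) :=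
  S^T = S /\ forall x : 'cV_n, 0 <= (x^T *m S *m x) 0 0.

(** Completing the square in the first coordinate. Since [0^-1 = 0], the last clause also makes
    sense for [a = 0], where the complement is just [drsubmx S]. *)
Lemma psd_schur n (S : 'M[R]_(1 + n)) (a := S 0 0) (v := dlsubmx S : 'cV_n) :
  psd S ->
  [/\ 0 <= a, (a = 0 -> v = 0) & psd (drsubmx S - a^-1 *: (v *m v^T))].
Proof.
case=> symS psdS.
have ulE : ulsubmx S = a%:M.
  by rewrite [LHS]mx11_scalar !mxE; congr (_%:M); congr (S _ _); apply/val_inj.
have urE : ursubmx S = v^T by rewrite trmx_dlsub symS.
have drE : (drsubmx S)^T = drsubmx S by rewrite trmx_drsub symS.
have formE t (y : 'cV_n) : 0 <= a * t ^+ 2 + 2 * t * (y^T *m v) 0 0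
    + (y^T *m drsubmx S *m y) 0 0.
  have := psdS (col_mx t%:M y).
  rewrite -{1}(submxK S) ulE urE tr_col_mx mul_row_block mul_row_col.
  rewrite tr_scalar_mx !mulmxDl -!scalar_mxM.
  rewrite mul_mx_scalar mul_scalar_mx -scalemxAl.
  have -> : v^T *m y = y^T *m v.
    by rewrite [LHS]mx11_scalar -tr_scalar_mx -mx11_scalar trmx_mul trmxK.
  rewrite !addmxE !scalemxE [_%:M 0 0]mxE mulr1n.
  set p := (y^T *m v) 0 0; set q := (_ *m _ *m _) 0 0.
  by move=> h; apply: (le_trans h); rewrite le_eqVlt; apply/orP; left; apply/eqP; ring.
split.
- have z0 : (0 : 'M[R]_1) 0 0 = 0 by rewrite mxE.
  by have := formE 1 0; rewrite !trmx0 !mul0mx z0 mulr0 !addr0 expr1n mulr1.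
- move=> a0; apply/eqP/negPn/negP => v0.
  set p := (v^T *m v) 0 0; set q := (v^T *m drsubmx S *m v) 0 0.
  have p0 : 0 < p.
    have [i vi] : exists i, v i 0 != 0.
      by move: v0 => /matrix0Pn[i [j]]; rewrite (ord1 j); exists i.
    rewrite /p mxE (bigD1 i)//= ltr_pwDl//.
      by rewrite mxE -expr2 lt_def sqrf_eq0 vi sqr_ge0.
    by apply: sumr_ge0 => j _; rewrite mxE -expr2 sqr_ge0.
  (* With [a = 0] the form is affine in [t], and this [t] gives it the value -1. *)
  have := formE (- (q + 1) / (2 * p)) v; rewrite a0 -/p -/q.
  have -> : 2 * (- (q + 1) / (2 * p)) * p = - (q + 1) by field; rewrite gt_eqF.
  lra.
- split=> [|y].
    by rewrite linearB/= linearZ/= trmx_mul trmxK drE.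
  rewrite mulmxBr mulmxBl -scalemxAr -scalemxAl.
  rewrite addmxE oppmxE scalemxE.
  have -> : (y^T *m (v *m v^T) *m y) 0 0 = (y^T *m v) 0 0 ^+ 2.
    rewrite !mulmxA -mulmxA.
    have -> : v^T *m y = y^T *m v.
      by rewrite [LHS]mx11_scalar -tr_scalar_mx -mx11_scalar trmx_mul trmxK.
    by rewrite [LHS]mxE big_ord1 expr2.
  (* This [t] minimizes the form when [a != 0]; when [a = 0] it is 0 and the form is already [q]. *)
  have := formE (- (a^-1 * (y^T *m v) 0 0)) y.
  set p := (y^T *m v) 0 0; set q := (_ *m _ *m _) 0 0.
  have [a0|a0] := eqVneq a 0; first by rewrite a0 invr0 !mul0r; lra.
  have -> : a * (- (a^-1 * p)) ^+ 2 + 2 * (- (a^-1 * p)) * p + q = q - a^-1 * p ^+ 2.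
    by field.
  by [].
Qed.

(** Cholesky factorization: the new column is [v / sqrt a], and the induction continues on the Schur
    complement. *)
Lemma psd_factor n (S : 'M[R]_n) : psd S -> exists B : 'M[R]_n, B *m B^T = S.
Proof.
elim: n S => [S _|n IH]; first by exists 0; apply/matrixP => -[].
rewrite -[n.+1]/(1 + n)%N => S psdS.
have [a0 av [symT psdT]] := @psd_schur n S psdS.
have [B BE] := IH _ (conj symT psdT).
set a := S 0 0 in a0 av BE; set v : 'cV_n := dlsubmx S in av BE.
exists (block_mx (Num.sqrt a)%:M 0 ((Num.sqrt a)^-1 *: v) B).
have sa2 : (Num.sqrt a) * (Num.sqrt a) = a by rewrite -expr2 sqr_sqrtr.
(* If [sqrt a = 0] then [v = 0], so the degenerate inverse is harmless. *)
have sv : Num.sqrt a *: ((Num.sqrt a)^-1 *: v) = v.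
  rewrite scalerA; have [/eqP|sa0] := eqVneq (Num.sqrt a) 0.
    rewrite sqrtr_eq0 => a0'; rewrite av ?scaler0//.
    by apply/eqP; rewrite eq_le a0 a0'.
  by rewrite divff// scale1r.
rewrite -[RHS]submxK tr_block_mx.
rewrite mulmx_block !trmx0 !mulmx0 !mul0mx !addr0 tr_scalar_mx; congr block_mx.
- rewrite -scalar_mxM sa2 [RHS]mx11_scalar !mxE; congr (_%:M); congr (S _ _); exact/val_inj.
- rewrite mul_scalar_mx -[LHS]linearZ/= sv -[RHS]trmxK trmx_ursub psdS.1.
  by [].
- by rewrite mul_mx_scalar sv.
- rewrite BE linearZ/= -scalemxAr -scalemxAl scalerA -invfM sa2.
  by rewrite -/v addrCA subrr addr0.
Qed.

Lemma psd_mulmx_tr m n (B : 'M[R]_(m, n)) : psd (B *m B^T).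
Proof.
split=> [|x]; first by rewrite trmx_mul trmxK.
rewrite mulmxA -mulmxA.
have -> : x^T *m B = (B^T *m x)^T by rewrite trmx_mul trmxK.
by rewrite mxE sumr_ge0// => i _; rewrite mxE -expr2 sqr_ge0.
Qed.

Lemma psdZ n k (S : 'M[R]_n) : 0 <= k -> psd S -> psd (k *: S).
Proof.
move=> k0 [symS psdS]; split=> [|x]; first by rewrite linearZ/= symS.
by rewrite -scalemxAr -scalemxAl mxE mulr_ge0.
Qed.

End Psd.

(** * Frobenius norms and the norm lost under [1 - P^T P] *)

Section Frobenius.
Context {R : realType}.

Lemma frob2E m k (Y : 'M[R]_(m, k)) : frob2 Y = \tr (Y^T *m Y).
Proof.
rewrite /frob2 exchange_big/=; apply: eq_bigr => j _.
by rewrite mxE; apply: eq_bigr => i _; rewrite mxE expr2.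
Qed.

Lemma frob2_tr m k (Y : 'M[R]_(m, k)) : frob2 Y^T = frob2 Y.
Proof. by rewrite !frob2E trmxK mxtrace_mulC. Qed.

Lemma frob2_ge0 m k (Y : 'M[R]_(m, k)) : 0 <= frob2 Y.
Proof. by rewrite sumr_ge0// => i _; rewrite sumr_ge0// => j _; exact: sqr_ge0. Qed.

Lemma frob2_gt0 m k (Y : 'M[R]_(m, k)) : Y != 0 -> 0 < frob2 Y.
Proof.
move=> /matrix0Pn[i [j Yij]].
rewrite /frob2 (bigD1 i)//= (bigD1 j)//= -addrA ltr_pwDl//.
  by rewrite lt_def sqrf_eq0 Yij sqr_ge0.
rewrite addr_ge0 ?sumr_ge0// => l _; first exact: sqr_ge0.
by rewrite sumr_ge0// => ? _; exact: sqr_ge0.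
Qed.

Lemma ge_frob2 m k (Y : 'M[R]_(m, k)) i j : Y i j ^+ 2 <= frob2 Y.
Proof.
rewrite /frob2 (bigD1 i)//= (bigD1 j)//= -addrA lerDl.
rewrite addr_ge0 ?sumr_ge0// => l _; first exact: sqr_ge0.
by rewrite sumr_ge0// => ? _; exact: sqr_ge0.
Qed.

Lemma frob2Z m k a (Y : 'M[R]_(m, k)) : frob2 (a *: Y) = a ^+ 2 * frob2 Y.
Proof.
rewrite /frob2 mulr_sumr; apply: eq_bigr => i _; rewrite mulr_sumr.
by apply: eq_bigr => j _; rewrite mxE exprMn.
Qed.

Lemma frob2B m k (Y Z : 'M[R]_(m, k)) :
  frob2 (Y - Z) = frob2 Y - 2 * \tr (Y^T *m Z) + frob2 Z.
Proof.
rewrite !frob2E [(Y - Z)^T]linearB/= mulmxBl !mulmxBr !linearB/=.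
have -> : \tr (Z^T *m Y) = \tr (Y^T *m Z).
  by rewrite -mxtrace_tr trmx_mul trmxK.
ring.
Qed.

(** The difference of the two sides is [frob2 (Y + Z)]. *)
Lemma frob2B_le m k (Y Z : 'M[R]_(m, k)) :
  frob2 (Y - Z) <= 2 * frob2 Y + 2 * frob2 Z.
Proof.
have := frob2_ge0 (Y - (- 1) *: Z); rewrite !frob2B frob2Z.
rewrite -scalemxAr mxtraceZ sqrrN expr1n; lra.
Qed.

Lemma trace_form_col n k (M : 'M[R]_n) (Z : 'M[R]_(n, k)) :
  \tr (Z^T *m M *m Z) = \sum_j ((col j Z)^T *m M *m col j Z) 0 0.
Proof.
apply: eq_bigr => j _; rewrite !mxE; apply: eq_bigr => i _.
by rewrite !mxE; congr (_ * _); apply: eq_bigr => l _; rewrite !mxE.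
Qed.

Lemma frob2_mul_form m n k (P : 'M[R]_(m, n)) (Z : 'M[R]_(n, k)) :
  frob2 (P *m Z) = \tr (Z^T *m (P^T *m P) *m Z).
Proof. by rewrite frob2E trmx_mul !mulmxA. Qed.

(** A matrix and its transpose have the same operator norm. Expanding [frob2 (b W - P P^T W) >= 0]
    and bounding its last term by the hypothesis gives the claim after division by [b]. *)
Lemma frob2_tr_le n k (P : 'M[R]_n) (b : R) (W : 'M[R]_(n, k)) : 0 < b ->
  (forall j (Z : 'M[R]_(n, j)), frob2 (P *m Z) <= b * frob2 Z) ->
  frob2 (P^T *m W) <= b * frob2 W.
Proof.
move=> b0 Pb; have := frob2_ge0 (b *: W - P *m (P^T *m W)).
rewrite frob2B frob2Z.
have -> : \tr ((b *: W)^T *m (P *m (P^T *m W))) = b * frob2 (P^T *m W).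
  by rewrite linearZ/= -scalemxAl linearZ/= frob2E trmx_mul trmxK !mulmxA.
have := Pb _ (P^T *m W); set q := frob2 (P^T *m W); move=> Pq h.
rewrite -(ler_pM2l b0).
have : b ^+ 2 * frob2 W = b * (b * frob2 W) by ring.
lra.
Qed.

(** The loss equals [2 frob2 (P Y) - frob2 (P^T P Y)], which is at least [(2 - b) frob2 (P Y)]. So
    it remains to compare the energies after and before applying [A]; the 10 is [2 + 2 * 2 * 2],
    from [frob2B_le] and two uses of [b <= 2]. *)
Lemma contraction_gap n k (P : 'M[R]_n) (b : R) (Y : 'M[R]_(n, k)) :
  0 < b -> b <= 2 ->
  (forall j (Z : 'M[R]_(n, j)), frob2 (P *m Z) <= b * frob2 Z) ->
  let A := 1%:M - P^T *m P in
  frob2 (A *m Y) <= frob2 Y /\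
  (2 - b) * frob2 (P *m (A *m Y)) <= 10 * (frob2 Y - frob2 (A *m Y)).
Proof.
move=> b0 b2 Pb A.
have PTb := frob2_tr_le (P *m Y) b0 Pb.
have AE : A *m Y = Y - P^T *m (P *m Y) by rewrite mulmxBl mul1mx mulmxA.
have gap : (2 - b) * frob2 (P *m Y) <= frob2 Y - frob2 (A *m Y).
  rewrite AE frob2B.
  have -> : \tr (Y^T *m (P^T *m (P *m Y))) = frob2 (P *m Y).
    by rewrite frob2_mul_form !mulmxA.
  lra.
have PY0 := frob2_ge0 (P *m Y).
have := mulr_ge0 _ PY0; rewrite -subr_ge0 in b2 => /(_ _ b2) h.
split; first lra.
have PA : frob2 (P *m (A *m Y)) <= 10 * frob2 (P *m Y).
  rewrite AE mulmxBr; apply: (le_trans (frob2B_le _ _)).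
  have := Pb _ (P^T *m (P *m Y)).
  have : b * frob2 (P^T *m (P *m Y)) <= 2 * (2 * frob2 (P *m Y)).
    by apply: ler_pM; rewrite ?frob2_ge0//; [lra|lra|nra].
  lra.
have : (2 - b) * frob2 (P *m (A *m Y)) <= (2 - b) * (10 * frob2 (P *m Y)).
  exact: ler_wpM2l.
lra.
Qed.

End Frobenius.

(** * Spectral bounds for the normalized adjacency *)

Section NormalizedAdjacency.
Context {R : realType}.
Variables (n : nat) (e : rel 'I_n).
Hypothesis e_sym : symmetric e.

Local Notation A := (Ahat e : 'M[R]_n).
Local Notation d := (deg e : 'I_n -> R).

Let dg i : 0 < 1 + d i.
Proof. by rewrite ltr_pwDl// sumr_ge0// => j _; rewrite mxE. Qed.

Lemma tr_Ahat : A^T = A.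
Proof.
apply/matrixP => i j; rewrite !mxE e_sym [j == i]eq_sym.
by rewrite [X in _ / X]mulrC.
Qed.

(* With [u_i = x_i / sqrt (1 + d_i)], both forms are sums over edges of
   [(u_i - s u_j)^2]; the self-loops contribute [(1 - s) u_i^2]. *)
Lemma Ahat_form (s : R) (x : 'cV[R]_n) (u := fun i => x i 0 / Num.sqrt (1 + d i)) :
  s ^+ 2 = 1 ->
  (x^T *m (1%:M - s *: A) *m x) 0 0 =
    (1 - s) * \sum_i u i ^+ 2
    + 2^-1 * \sum_i \sum_j adj e i j * (u i - s * u j) ^+ 2.
Proof.
move=> s2.
have xE i : x i 0 = u i * Num.sqrt (1 + d i).
  by rewrite /u divfK// gt_eqF// sqrtr_gt0.
have xx : (x^T *m x) 0 0 = \sum_i u i ^+ 2 + \sum_i \sum_j adj e i j * u i ^+ 2.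
  rewrite mxE -big_split/=; apply: eq_bigr => i _.
  rewrite mxE xE mulrACA -!expr2 sqr_sqrtr ?ltW// mulrDr mulr1.
  by congr (_ + _); rewrite mulrC mulr_suml.
have xAx : (x^T *m A *m x) 0 0 =
    \sum_i u i ^+ 2 + \sum_i \sum_j adj e i j * (u i * u j).
  rewrite mxE (eq_bigr (fun j => \sum_i x i 0 * A i j * x j 0)); last first.
    by move=> j _; rewrite mxE mulr_suml; apply: eq_bigr => i _; rewrite mxE.
  rewrite exchange_big/= -big_split/=; apply: eq_bigr => i _.
  rewrite (eq_bigr (fun j => (i == j)%:R * u i ^+ 2 + adj e i j * (u i * u j))).
    rewrite big_split/= (bigD1 i)//= eqxx mul1r big1 ?addr0// => j ji.
    by rewrite eq_sym (negbTE ji) mul0r.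
  move=> j _; rewrite mxE invfM addmxE [1%:M i j]mxE.
  transitivity ((adj e i j + (i == j)%:R) * (u i * u j)); first by rewrite /u; ring.
  by have [->|_] := eqVneq i j; rewrite ?mulr1n ?mulr0n ?expr2; ring.
rewrite mulmxBr mulmxBl mulmx1 -scalemxAr -scalemxAl.
rewrite addmxE oppmxE scalemxE xx xAx.
rewrite [X in _ = _ + 2^-1 * X](eq_bigr (fun i => \sum_j adj e i j * u i ^+ 2
    - s * (2 * \sum_j adj e i j * (u i * u j)) + \sum_j adj e i j * u j ^+ 2)).
  rewrite !big_split/= sumrN -!mulr_sumr.
  have -> : \sum_i \sum_j adj e i j * u j ^+ 2 = \sum_i \sum_j adj e i j * u i ^+ 2.
    rewrite exchange_big/=; apply: eq_bigr => i _; apply: eq_bigr => j _.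
    by rewrite !mxE e_sym.
  by field.
move=> i _; rewrite !mulr_sumr -sumrN -!big_split/=; apply: eq_bigr => j _.
by rewrite sqrrB [(s * _) ^+ 2]exprMn s2; ring.
Qed.

Lemma psd_sub_Ahat (s : R) : s ^+ 2 = 1 -> psd (1%:M - s *: A).
Proof.
move=> s2; split; first by rewrite linearB/= linearZ/= tr_Ahat trmx1.
move=> x; rewrite Ahat_form//.
have s1 : 0 <= 1 - s.
  by rewrite subr_ge0; have := sqr_ge0 (1 - s); have := sqr_ge0 (1 + s); nra.
rewrite addr_ge0// mulr_ge0// ?invr_ge0// sumr_ge0// => i _; first exact: sqr_ge0.
by rewrite sumr_ge0// => j _; rewrite mxE mulr_ge0// sqr_ge0.
Qed.

(** Since [2 - Lhat = 1 + A], the form identity at [s = -1] bounds this matrix below by the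
    self-loop term [2 * \sum_i u_i^2], and [u_i^2 = x_i^2 / (1 + d_i)] with [d_i <= n]. *)
Lemma Lhat_form_le k (Z : 'M[R]_(n, k)) :
  \tr (Z^T *m Lhat e *m Z) <= (2 - 2 / n.+1%:R) * frob2 Z.
Proof.
rewrite trace_form_col frob2E -[in leRHS](mulmx1 Z^T) trace_form_col mulr_sumr; apply: ler_sum => j _.
set x := col j Z; rewrite mulmx1.
have := @Ahat_form (-1) x; rewrite sqrrN expr1n => /(_ erefl).
set U := \sum_i (x i 0 / _) ^+ 2; set E := \sum_i \sum_j _.
have E0 : 0 <= E.
  by rewrite sumr_ge0// => i _; rewrite sumr_ge0// => l _; rewrite mxE mulr_ge0// sqr_ge0.
have Ux : n.+1%:R^-1 * (x^T *m x) 0 0 <= U.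
  rewrite mxE mulr_sumr; apply: ler_sum => i _; rewrite mxE -expr2 exprMn exprVn.
  rewrite sqr_sqrtr; last exact/ltW.
  rewrite mulrC; apply: ler_wpM2l; first exact: sqr_ge0.
  rewrite lef_pV2 ?posrE// -natr1 addrC lerD2r /deg.
  rewrite -[leRHS](_ : \sum_(l < n) 1 = _); last by rewrite sumr_const card_ord.
  by apply: ler_sum => l _; rewrite mxE lern1 leq_b1.
set p := (x^T *m x) 0 0 in Ux *; set q := (x^T *m A *m x) 0 0.
have formE s : (x^T *m (1%:M - s *: A) *m x) 0 0 = p - s * q.
  rewrite mulmxBr mulmxBl mulmx1 -scalemxAr -scalemxAl.
  by rewrite addmxE oppmxE scalemxE.
have -> : Lhat e = 1%:M - 1 *: A by rewrite scale1r.
rewrite !formE; set cp := _^-1 * p in Ux *.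
have -> : (2 - 2 / n.+1%:R) * p = 2 * p - 2 * cp by rewrite /cp; ring.
lra.
Qed.

Lemma Lhat_factor : exists P : 'M[R]_n, Lhat e = P^T *m P.
Proof.
have [B BE] : exists B : 'M[R]_n, B *m B^T = Lhat e.
  apply: psd_factor; by have := psd_sub_Ahat (expr1n _ 2); rewrite scale1r.
by exists B^T; rewrite trmxK.
Qed.

Lemma dirichletE (P : 'M[R]_n) C (H : 'M[R]_(n, C)) :
  Lhat e = P^T *m P -> dirichlet e H = frob2 (P *m H).
Proof. by move=> PE; rewrite /dirichlet PE frob2_mul_form. Qed.

Lemma dirichlet_le C (H : 'M[R]_(n, C)) : dirichlet e H <= 2 * frob2 H.
Proof.
apply: (le_trans (Lhat_form_le H)).
by rewrite ler_wpM2r ?frob2_ge0// gerBl divr_ge0.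
Qed.

(** [contraction_gap] with [b = 2 - 2 / (n + 1)]: the constant is [10 / (2 - b) = 5 (n + 1)]. *)
Lemma Ahat_gap (P : 'M[R]_n) k (Y : 'M[R]_(n, k)) : (0 < n)%N -> Lhat e = P^T *m P ->
  frob2 (A *m Y) <= frob2 Y /\
  frob2 (P *m (A *m Y)) <= (5 * n.+1%:R) * (frob2 Y - frob2 (A *m Y)).
Proof.
move=> n0 PE.
have n1 : (1 : R) <= n%:R by rewrite ler1n.
have nE : (n.+1%:R : R) = n%:R + 1 by rewrite -natr1.
have np : 0 < n.+1%:R :> R by [].
have i0 : 0 < 2 / n.+1%:R :> R by rewrite divr_gt0.
have i1 : 2 / n.+1%:R < 2 :> R.
  by rewrite ltr_pdivrMr// nE; lra.
have [] := @contraction_gap R n k P (2 - 2 / n.+1%:R) Y.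
- by rewrite subr_gt0.
- by rewrite gerBl ltW.
- by move=> j Z; rewrite frob2_mul_form -PE Lhat_form_le.
rewrite -PE /Lhat opprB addrCA subrr addr0 => h1 h2; split => //.
rewrite -(ler_pM2l i0); move: h2; rewrite opprB addrCA subrr addr0 => /le_trans; apply.
by rewrite mulrA (_ : 2 / n.+1%:R * (5 * n.+1%:R) = 10)//; field; rewrite gt_eqF.
Qed.

End NormalizedAdjacency.

(** * The standard normal law *)

Section StandardNormal.
Context {R : realType}.
Local Notation mu := (@lebesgue_measure R).
Local Notation N01 := (@normal_prob R 0 1).
Import HBNNSimple.

(** Change of density: checked on simple functions, then extended by monotone convergence on both
    sides. *)
Lemma ge0_integral_normal_prob m s (f : measurableTypeR R -> \bar R) :
  measurable_fun setT f -> (forall x, 0 <= f x)%E ->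
  (\int[normal_prob m s]_x f x = \int[mu]_x (f x * (normal_pdf m s x)%:E))%E.
Proof.
move=> mf f0.
have mpdf : measurable_fun setT (fun x => (normal_pdf m s x)%:E).
  by apply/measurable_EFinP; exact: measurable_normal_pdf.
have pdf0 x : (0 <= (normal_pdf m s x)%:E)%E by rewrite lee_fin normal_pdf_ge0.
pose f_ := nnsfun_approx measurableT mf.
have f_cvg x : (f_ n x)%:E @[n --> \oo] --> f x by exact: cvg_nnsfun_approx.
have f_nd x : {homo (fun n => (f_ n x)%:E) : a b / (a <= b)%N >-> (a <= b)%E}.
  by move=> a b ab; rewrite lee_fin; exact/lefP/nd_nnsfun_approx.
have nnsfunE (g : {nnsfun measurableTypeR R >-> R}) :
    (\int[normal_prob m s]_x (g x)%:E = \int[mu]_x ((g x)%:E * (normal_pdf m s x)%:E))%E.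
  under [LHS]eq_integral do rewrite fimfunE -fsumEFin//.
  rewrite [LHS]ge0_integral_fsum//; last 2 first.
  - by move=> r; exact/measurable_EFinP/measurableT_comp.
  - by move=> r x _; rewrite EFinM nnfun_muleindic_ge0.
  under [RHS]eq_integral.
    move=> x _; rewrite fimfunE -fsumEFin// ge0_mule_fsuml; last first.
      by move=> r; rewrite EFinM nnfun_muleindic_ge0.
    over.
  rewrite [RHS]ge0_integral_fsum//; last 2 first.
  - move=> r; apply: emeasurable_funM => //.
    exact/measurable_EFinP/measurableT_comp.
  - by move=> r x _; rewrite mule_ge0// EFinM nnfun_muleindic_ge0.
  apply: eq_fsbigr => r _.
  under [RHS]eq_integral do rewrite EFinM -muleA.
  have [r0|r0] := leP 0 r; last first.
    rewrite (preimage_nnfun0 _ r0).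
    by rewrite !integral0_eq// => x _; rewrite indic0 ?mul0e ?mule0 ?EFinM ?mule0.
  rewrite integralZl_indic_nnsfun// ge0_integralZl//; last 2 first.
  - apply: emeasurable_funM => //; exact/measurable_EFinP.
  - by move=> x _; rewrite mule_ge0.
  rewrite integral_indic//= setIT /normal_prob [in LHS]integral_mkcond; congr (_ * _)%E.
  apply: eq_integral => x _; rewrite patchE indicE muleC.
  by case: ifPn => _; rewrite ?mule1 ?mule0.
transitivity (limn (fun n => \int[normal_prob m s]_x (f_ n x)%:E))%E.
  rewrite -monotone_convergence//=.
  - by apply: eq_integral => x _; exact/esym/cvg_lim.
  - by move=> n; exact/measurable_EFinP.
  - by move=> n x _; rewrite lee_fin.
under eq_fun do rewrite nnsfunE.
rewrite -monotone_convergence//=.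
- apply: eq_integral => x _; apply/cvg_lim => //; exact: cvgeZr.
- by move=> n; apply: emeasurable_funM => //; exact/measurable_EFinP.
- by move=> n x _; rewrite mule_ge0// lee_fin.
- by move=> x _ a b ab; rewrite lee_wpmul2r// f_nd.
Qed.

(** The density is even and Lebesgue measure is invariant under reflection. *)
Lemma integral_normal_probN (f : measurableTypeR R -> \bar R) :
  measurable_fun setT f -> (forall x, 0 <= f x)%E ->
  (\int[normal_prob 0 1]_x f (- x)%R = \int[normal_prob 0 1]_x f x)%E.
Proof.
move=> mf f0.
have mN : measurable_fun setT (-%R : measurableTypeR R -> measurableTypeR R).
  exact: oppr_measurable.
rewrite !ge0_integral_normal_prob//; last exact: measurableT_comp.
pose g x := (f x * (normal_pdf 0 1 x)%:E)%E.
have mg : measurable_fun setT g.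
  by apply: emeasurable_funM => //; apply/measurable_EFinP; exact: measurable_normal_pdf.
have pdfN x : normal_pdf 0 1 (- x) = normal_pdf 0 1 x :> R.
  by rewrite !normal_pdfE ?oner_neq0// /normal_fun !subr0 sqrrN.
transitivity (\int[mu]_x (g \o -%R) x)%E.
  by apply: eq_integral => x _; rewrite /g/= pdfN.
transitivity (\int[pushforward mu (-%R : R -> measurableTypeR R)]_x g x)%E.
  rewrite ge0_integral_pushforward// => x _.
  by rewrite mule_ge0// lee_fin normal_pdf_ge0.
by apply: (eq_measure_integral mu) => A mA _; exact: lebesgue_measureN.
Qed.

Lemma normal_prob_le_lebesgue m s (A : set (measurableTypeR R)) : s != 0 -> measurable A ->
  (normal_prob m s A <= (normal_peak s)%:E * mu A)%E.
Proof.
move=> s0 mA; rewrite -integral_cst//.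
apply: ge0_le_integral => //=.
- by move=> x _; rewrite lee_fin normal_pdf_ge0.
- by apply/measurable_funTS/measurable_EFinP; exact: measurable_normal_pdf.
- by move=> x _; rewrite lee_fin normal_pdf_ub.
Qed.

Lemma integral_normal_prob_cst m s (c : \bar R) : (\int[normal_prob m s]_x c = c)%E.
Proof.
rewrite integral_cst//= -[RHS]mule1; congr (_ * _)%E.
exact: (@probability_setT _ _ _ (normal_prob m s)).
Qed.

Local Notation kappa := (\int[N01]_x (x ^+ 2)%:E)%E.

Let measurable_sqr : measurable_fun setT (fun x : measurableTypeR R => (x ^+ 2)%:E).
Proof. by apply/measurable_EFinP; exact: exprn_measurable. Qed.

Let kappaE : kappa = (\int[mu]_x (x ^+ 2 * normal_pdf 0 1 x)%:E)%E.
Proof. by rewrite ge0_integral_normal_prob// => x; rewrite lee_fin sqr_ge0. Qed.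

(* [1 + t <= exp t] compares the densities of N(0, s^2) and N(0, 1). *)
Let normal_pdf_tangent (s x : R) : 0 < s ->
  normal_pdf 0 1 x + (1 - s ^- 2) / 2 * (x ^+ 2 * normal_pdf 0 1 x)
    <= s * normal_pdf 0 s x.
Proof.
move=> s0; rewrite !normal_pdfE ?oner_neq0 ?gt_eqF// /normal_peak /normal_fun.
rewrite !subr0 expr1n mul1r.
have -> : Num.sqrt (s ^+ 2 * pi *+ 2) = s * Num.sqrt (pi *+ 2).
  by rewrite -mulrnAr sqrtrM ?sqr_ge0// sqrtr_sqr ger0_norm// ltW.
rewrite [(s * Num.sqrt _)^-1]invfM !mulrA divff ?gt_eqF// mul1r.
set c := (Num.sqrt _)^-1.
have c0 : 0 <= c by rewrite invr_ge0 sqrtr_ge0.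
have -> : - x ^+ 2 / (s ^+ 2 *+ 2) = - x ^+ 2 / 2 + (1 - s ^- 2) / 2 * x ^+ 2.
  by field; rewrite gt_eqF.
rewrite expRD mulrA.
set E := c * _.
have E0 : 0 <= E by rewrite mulr_ge0// expR_ge0.
have := expR_ge1Dx ((1 - s ^- 2) / 2 * x ^+ 2) => h.
have := ler_wpM2l E0 h; apply: le_trans.
by rewrite le_eqVlt; apply/orP; left; apply/eqP; rewrite /E; ring.
Qed.

Let integral_scaled_pdf (s : R) : 0 < s -> (\int[mu]_x (s * normal_pdf 0 s x)%:E = s%:E)%E.
Proof.
move=> s0; under eq_integral do rewrite EFinM.
rewrite ge0_integralZl//.
- by rewrite integral_normal_pdf mule1.
- by apply/measurable_EFinP; exact: measurable_normal_pdf.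
- by move=> x _; rewrite lee_fin normal_pdf_ge0.
- by rewrite lee_fin ltW.
Qed.

Let measurable_sqr_pdf (k : R) :
  measurable_fun setT (fun x : measurableTypeR R => (k * (x ^+ 2 * normal_pdf 0 1 x))%:E).
Proof.
apply/measurable_EFinP; apply: measurable_funM => //; apply: measurable_funM.
  exact: exprn_measurable.
exact: measurable_normal_pdf.
Qed.

Let sqr_pdf_ge0 (k x : R) : 0 <= k -> 0 <= k * (x ^+ 2 * normal_pdf 0 1 x).
Proof. by move=> k0; rewrite mulr_ge0// mulr_ge0 ?normal_pdf_ge0 ?sqr_ge0. Qed.

Let kappaZ (k : R) : 0 <= k ->
  (\int[mu]_x (k * (x ^+ 2 * normal_pdf 0 1 x))%:E = k%:E * kappa)%E.
Proof.
move=> k0; rewrite kappaE -ge0_integralZl//=.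
- by have := measurable_sqr_pdf 1; under eq_fun do rewrite mul1r.
- by move=> x _; rewrite lee_fin mulr_ge0 ?sqr_ge0 ?normal_pdf_ge0.
Qed.

(** The tangent inequality integrated over the line, both densities having mass 1. *)
Let kappa_le (s : R) : 1 < s -> (((1 - s ^- 2) / 2)%:E * kappa <= (s - 1)%:E)%E.
Proof.
move=> s1; have s0 : 0 < s by rewrite (lt_trans _ s1).
have k0 : 0 <= (1 - s ^- 2) / 2.
  by rewrite divr_ge0// subr_ge0 invf_le1 ?exprn_gt0// expr_ge1 ?ltW.
rewrite EFinB leeBrDl// -(integral_scaled_pdf s0) -(integral_normal_pdf (0 : R) 1).
rewrite -kappaZ// -ge0_integralD//=.
- apply: ge0_le_integral => //=.
  + by move=> x _; rewrite -EFinD lee_fin addr_ge0 ?sqr_pdf_ge0 ?normal_pdf_ge0.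
  + apply: emeasurable_funD => //; apply/measurable_EFinP; exact: measurable_normal_pdf.
  + by apply/measurable_EFinP; apply: measurable_funM => //; exact: measurable_normal_pdf.
  + by move=> x _; rewrite -EFinD lee_fin normal_pdf_tangent.
- by move=> x _; rewrite lee_fin normal_pdf_ge0.
- by apply/measurable_EFinP; exact: measurable_normal_pdf.
- by move=> x _; rewrite lee_fin sqr_pdf_ge0.
Qed.

(** The same inequality for [s < 1], where the coefficient of the square is negative: that term
    changes sides before integration, so that all integrands stay nonnegative. *)
Let kappa_ge (s : R) : 0 < s < 1 -> ((1 - s)%:E <= ((s ^- 2 - 1) / 2)%:E * kappa)%E.
Proof.
move=> /andP[s0 s1].
have k0 : 0 <= (s ^- 2 - 1) / 2.
  by rewrite divr_ge0// subr_ge0 invf_ge1 ?exprn_gt0// expr_le1 ?ltW.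
rewrite EFinB leeBlDr// -(integral_scaled_pdf s0) -(integral_normal_pdf (0 : R) 1).
rewrite -kappaZ// -ge0_integralD//=.
- apply: ge0_le_integral => //=.
  + by move=> x _; rewrite lee_fin normal_pdf_ge0.
  + by apply/measurable_EFinP; exact: measurable_normal_pdf.
  + apply: emeasurable_funD => //; apply/measurable_EFinP.
    by apply: measurable_funM => //; exact: measurable_normal_pdf.
  + move=> x _; rewrite -EFinD lee_fin; have := normal_pdf_tangent x s0.
    set p := x ^+ 2 * _; have -> : (1 - s ^- 2) / 2 * p = - ((s ^- 2 - 1) / 2 * p) by ring.
    by lra.
- by move=> x _; rewrite lee_fin sqr_pdf_ge0.
- by move=> x _; rewrite lee_fin mulr_ge0 ?normal_pdf_ge0// ltW.
- by apply/measurable_EFinP; apply: measurable_funM => //; exact: measurable_normal_pdf.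
Qed.

(** The two comparisons squeeze the second moment: it is at most [2 s^2 / (s + 1)] for [s > 1] and
    at least that for [s < 1], and this quantity tends to 1 as [s] does. *)
Lemma integral_normal_prob_sqr : kappa = 1%E.
Proof.
have k_ge0 : (0 <= kappa)%E by apply: integral_ge0 => x _; rewrite lee_fin sqr_ge0.
(* The comparison at [s = 2] already excludes an infinite value. *)
have k_fin : kappa \is a fin_num.
  rewrite ge0_fin_numE//; have := @kappa_le 2; rewrite ltr1n => /(_ isT).
  case: kappa k_ge0 => [r _|_|//]; first by rewrite ltry.
  rewrite gt0_muley; first by rewrite leye_eq.
  by rewrite lte_fin -natrX; lra.
have [k kE] : exists k, kappa = k%:E by exists (fine kappa); rewrite fineK.
rewrite kE; congr _%:E.
have le_k s : 1 < s -> k * (s + 1) <= 2 * s ^+ 2.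
  move=> s1; have s0 : 0 < s by rewrite (lt_trans _ s1).
  have := kappa_le s1; rewrite kE -EFinM lee_fin.
  have -> : (1 - s ^- 2) / 2 * k = (s - 1) * (k * (s + 1) / (2 * s ^+ 2)).
    by field; rewrite gt_eqF.
  rewrite -[leRHS]mulr1 ler_pM2l ?subr_gt0// ler_pdivrMr ?mul1r//.
  by rewrite mulr_gt0// exprn_gt0.
have ge_k s : 0 < s < 1 -> 2 * s ^+ 2 <= k * (s + 1).
  move=> s01; have /andP[s0 s1] := s01.
  have := kappa_ge s01; rewrite kE -EFinM lee_fin.
  have -> : (s ^- 2 - 1) / 2 * k = (1 - s) * (k * (s + 1) / (2 * s ^+ 2)).
    by field; rewrite gt_eqF.
  rewrite -[leLHS]mulr1 ler_pM2l ?subr_gt0// ler_pdivlMr ?mul1r//.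
  by rewrite mulr_gt0// exprn_gt0.
have k0 : 0 <= k by move: k_ge0; rewrite kE.
have k1 : k < 2 by have := @le_k (3 / 2); lra.
(* A deviation of [k] from 1 is refuted at an [s] on the same side of 1, at an eighth of the
   distance: near 1 the bound has slope 3/2 in [s], too small to reach [k]. *)
apply/eqP; rewrite eq_le; apply/andP; split; rewrite leNgt; apply/negP => hk.
- have := @le_k (1 + (k - 1) / 8).
  have h : 1 < 1 + (k - 1) / 8 by lra.
  move=> /(_ h); nra.
- have := @ge_k (1 - (1 - k) / 8).
  have h : 0 < 1 - (1 - k) / 8 < 1 by apply/andP; split; lra.
  move=> /(_ h); nra.
Qed.

Lemma integral_normal_prob_affine_sqr (c a : R) :
  (\int[N01]_x ((c + a * x) ^+ 2)%:E = (c ^+ 2 + a ^+ 2)%:E)%E.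
Proof.
have mf b : measurable_fun setT (fun x : measurableTypeR R => ((c + b * x) ^+ 2)%:E).
  apply/measurable_EFinP; apply: measurable_funX; exact: measurable_funD.
have f0 b x : (0 <= ((c + b * x) ^+ 2)%:E :> \bar R)%E by rewrite lee_fin sqr_ge0.
have sym := integral_normal_probN (mf a) (f0 a).
(* Adding the integral reflected by [x -> - x] cancels the cross term, which has no sign. *)
have sum : (\int[N01]_x ((c + a * x) ^+ 2)%:E + \int[N01]_x ((c + a * x) ^+ 2)%:E =
    (2 * (c ^+ 2 + a ^+ 2))%:E)%E.
  rewrite -{2}sym -ge0_integralD//; last first.
    by have := mf (- a); under eq_fun do rewrite mulNr -mulrN.
  under eq_integral.
    move=> x _; rewrite -EFinD.
    rewrite (_ : _ + _ = 2 * c ^+ 2 + (2 * a ^+ 2) * x ^+ 2); last by ring.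
    rewrite EFinD [X in (_ + X)%E]EFinM; over.
  have a0 : 0 <= 2 * a ^+ 2 by rewrite mulr_ge0// sqr_ge0.
  rewrite ge0_integralD//=; last 3 first.
  - by move=> x _; rewrite lee_fin mulr_ge0// sqr_ge0.
  - by move=> x _; rewrite mule_ge0// lee_fin// sqr_ge0.
  - by apply: emeasurable_funM.
  rewrite integral_normal_prob_cst ge0_integralZl//.
  - by rewrite integral_normal_prob_sqr mule1 -EFinD mulrDr.
  - by move=> x _; rewrite lee_fin sqr_ge0.
have : (0 <= \int[N01]_x ((c + a * x) ^+ 2)%:E)%E by exact: integral_ge0.
case: (integral _ _ _) sum => [r||]//; rewrite -EFinD => -[rE] _.
by congr _%:E; lra.
Qed.

Lemma normal_prob_small_affine (c a d : R) : a != 0 -> 0 < d ->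
  (\int[N01]_x ((c + a * x) ^+ 2 < d)%R%:R%:E
     <= (normal_peak 1 * (2 * Num.sqrt d / `|a|))%:E)%E.
Proof.
move=> a0 d0; set A := ball (- c / a) (Num.sqrt d / `|a|) : set (measurableTypeR R).
have na0 : 0 < `|a| by rewrite normr_gt0.
have r0 : 0 < Num.sqrt d / `|a| by rewrite divr_gt0// sqrtr_gt0.
have mA : measurable A by exact: measurable_ball.
rewrite (eq_integral (fun x => (\1_A x)%:E)); last first.
  move=> x _; rewrite indicE -[in LHS](ltr_sqrt _ d0) sqrtr_sqr.
  have -> : `|c + a * x| = `|- c / a - x| * `|a|.
    by rewrite -normrM -[LHS]normrN; congr `|_|; field.
  rewrite -ltr_pdivlMr//; congr ((nat_of_bool _)%:R%:E).
  by apply/idP/idP; rewrite inE /A -ball_normE.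
rewrite integral_indic// setIT.
apply: (le_trans (normal_prob_le_lebesgue _ (oner_neq0 _) mA)).
rewrite EFinM lee_wpmul2l// ?lee_fin ?normal_peak_ge0//.
by rewrite (lebesgue_measure_ball _ (ltW r0)) lee_fin -mulrA mulr_natl.
Qed.

End StandardNormal.

(** * Iterated Gaussian integrals *)

Section SeqMeasurable.
Context {R : realType}.

(* Joint measurability of [f t s] in [t] and the first [m] entries of [s]. *)
Fixpoint seq_measurable dV (V : measurableType dV) (m : nat) :
    forall d (T : measurableType d), (T -> seq R -> V) -> Prop :=
  match m with
  | 0 => fun d T f => measurable_fun setT (f ^~ [::])
  | m'.+1 => fun d T f =>
      seq_measurable m' (fun (p : T * measurableTypeR R) s => f p.1 (p.2 :: s))
  end.

Lemma seq_measurable_op2 d1 d2 d3 (V1 : measurableType d1) (V2 : measurableType d2)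
    (V3 : measurableType d3) (op : V1 -> V2 -> V3) :
  (forall d (T : measurableType d) (f : T -> V1) (g : T -> V2),
     measurable_fun setT f -> measurable_fun setT g ->
     measurable_fun setT (fun t => op (f t) (g t))) ->
  forall m d (T : measurableType d) (f : T -> seq R -> V1) (g : T -> seq R -> V2),
    seq_measurable m f -> seq_measurable m g ->
    seq_measurable m (fun t s => op (f t s) (g t s)).
Proof.
move=> mop; elim=> [|m IH] d T f g /= mf mg; first exact: mop.
exact: (IH _ _ _ _ mf mg).
Qed.

Lemma seq_measurable_comp d1 d2 (V1 : measurableType d1) (V2 : measurableType d2)
    (h : V1 -> V2) m d (T : measurableType d) (f : T -> seq R -> V1) :
  measurable_fun setT h -> seq_measurable m f ->
  seq_measurable m (fun t s => h (f t s)).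
Proof.
move=> mh mf; apply: (@seq_measurable_op2 _ _ _ _ _ _ (fun x _ : V1 => h x) _ _ _ _ _ _ mf mf).
by move=> ? ? g _ mg _; exact: measurableT_comp.
Qed.

Lemma seq_measurable_precomp dV (V : measurableType dV) m d d' (T : measurableType d)
    (T' : measurableType d') (g : T' -> T) (f : T -> seq R -> V) :
  measurable_fun setT g -> seq_measurable m f ->
  seq_measurable m (fun t s => f (g t) s).
Proof.
elim: m d d' T T' g f => [|m IH] d d' T T' g f mg /= mf.
  exact: (measurableT_comp (f := f ^~ [::])).
have mg' : measurable_fun setT
    (fun p : T' * measurableTypeR R => (g p.1, p.2)).
  apply: measurable_fun_pair => //=; exact: measurableT_comp.
exact: (IH _ _ _ _ _ _ mg' mf).
Qed.

Lemma seq_measurable_param dV (V : measurableType dV) m d (T : measurableType d)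
    (g : T -> V) : measurable_fun setT g -> seq_measurable m (fun t _ => g t).
Proof.
elim: m d T g => [|m IH] d T g mg //=.
apply: (IH _ _ (fun p : T * measurableTypeR R => g p.1)); exact: measurableT_comp.
Qed.

Lemma seq_measurable_nth m d (T : measurableType d) k :
  seq_measurable m (fun (t : T) s => nth 0 s k : R).
Proof.
elim: m d T k => [|m IH] d T k /=; first exact: measurable_cst.
by case: k => [|k] //=; exact: seq_measurable_param.
Qed.

Lemma seq_measurable_sum m d (T : measurableType d) (I : Type) (r : seq I)
    (F : I -> T -> seq R -> R) :
  (forall i, seq_measurable m (F i)) ->
  seq_measurable m (fun t s => \sum_(i <- r) F i t s).
Proof.
move=> mF; elim: r => [|i r IH].
  rewrite (_ : (fun t s => _) = (fun _ _ => 0)).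
    by apply: seq_measurable_param; exact: measurable_cst.
  by apply/funext => t; apply/funext => s; rewrite big_nil.
rewrite (_ : (fun t s => _) = (fun t s => F i t s + \sum_(j <- r) F j t s)).
  apply: (@seq_measurable_op2 _ _ _ R R R (fun x y => x + y) _ _ _ _ _ _ (mF i) IH).
  by move=> *; exact: measurable_funD.
by apply/funext => t; apply/funext => s; rewrite big_cons.
Qed.

End SeqMeasurable.

(** * Measurability, linearity and Tonelli for iterated Gaussian integrals *)

Section StdGaussIter.
Context {R : realType}.
Local Notation N01 := (@normal_prob R 0 1).
Local Open Scope ereal_scope.

Lemma std_gauss_iter_ge0 m (f : seq R -> \bar R) :
  (forall s, 0 <= f s) -> 0 <= std_gauss_iter m f.
Proof.
elim: m f => [|m IH] f f0 //=.
by apply: integral_ge0 => x _; exact: IH.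
Qed.

Lemma measurable_std_gauss_iter m d (T : measurableType d) (f : T -> seq R -> \bar R) :
  seq_measurable m f -> (forall t s, 0 <= f t s) ->
  measurable_fun setT (fun t => std_gauss_iter m (f t)).
Proof.
elim: m d T f => [|m IH] d T f //= mf f0.
have := IH _ _ _ mf (fun p s => f0 p.1 (p.2 :: s)).
move=> /(@measurable_fun_fubini_tonelli_F _ _ T (measurableTypeR R) R N01); apply.
by move=> p; exact: std_gauss_iter_ge0.
Qed.

Lemma measurable_std_gauss_iter_cons m d (T : measurableType d)
    (f : T -> seq R -> \bar R) t :
  seq_measurable m.+1 f -> (forall t s, 0 <= f t s) ->
  measurable_fun setT
    (fun x : measurableTypeR R => std_gauss_iter m (fun s => f t (x :: s))).
Proof.
move=> mf f0.
have := @measurable_std_gauss_iter m _ (T * measurableTypeR R)%type _ mf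
  (fun p s => f0 p.1 (p.2 :: s)).
by move=> /measurableT_comp/(_ (pair1_measurable t)).
Qed.

Lemma eq_std_gauss_iter m (f g : seq R -> \bar R) :
  f =1 g -> std_gauss_iter m f = std_gauss_iter m g.
Proof. by move=> /funext ->. Qed.

Lemma std_gauss_iter_cst m (c : \bar R) : std_gauss_iter m (fun=> c) = c.
Proof.
elim: m => //= m IH; under eq_integral do rewrite IH.
exact: integral_normal_prob_cst.
Qed.

Section Linearity.
Context d (T : measurableType d).
Variables (m : nat) (f g : T -> seq R -> \bar R).
Hypotheses (mf : seq_measurable m f) (f0 : forall t s, 0 <= f t s).

(** Here and in the next lemmas the induction moves the first coordinate into the parameter, using
    the hypothesis at [(t, x)]; this is why a general parameter space [T] is carried along. *)
Lemma std_gauss_iterD t : seq_measurable m g -> (forall t s, 0 <= g t s) ->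
  std_gauss_iter m (fun s => f t s + g t s) =
  std_gauss_iter m (f t) + std_gauss_iter m (g t).
Proof.
elim: m d T f g mf f0 t => [|k IH] d' T' f' g' //= mf' f0' t mg' g0'.
rewrite -ge0_integralD//=; last 4 first.
- by move=> x _; exact: std_gauss_iter_ge0.
- exact: measurable_std_gauss_iter_cons.
- by move=> x _; exact: std_gauss_iter_ge0.
- exact: measurable_std_gauss_iter_cons.
apply: eq_integral => x _.
exact: (IH _ _ _ _ mf' (fun p s => f0' p.1 (p.2 :: s)) (t, x) mg').
Qed.

Lemma std_gauss_iterZl t (c : R) : (0 <= c)%R ->
  std_gauss_iter m (fun s => c%:E * f t s) = c%:E * std_gauss_iter m (f t).
Proof.
move=> c0; elim: m d T f mf f0 t => [|k IH] d' T' f' //= mf' f0' t.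
rewrite -ge0_integralZl//=; last 2 first.
- exact: measurable_std_gauss_iter_cons.
- by move=> x _; exact: std_gauss_iter_ge0.
apply: eq_integral => x _.
exact: (IH _ _ _ mf' (fun p s => f0' p.1 (p.2 :: s)) (t, x)).
Qed.

Lemma le_std_gauss_iter t : seq_measurable m g -> (forall t s, f t s <= g t s) ->
  std_gauss_iter m (f t) <= std_gauss_iter m (g t).
Proof.
elim: m d T f g mf f0 t => [|k IH] d' T' f' g' //= mf' f0' t mg' fg'.
have g0' t' s : 0 <= g' t' s by exact: le_trans (fg' t' s).
apply: ge0_le_integral => //=.
- by move=> x _; exact: std_gauss_iter_ge0.
- exact: measurable_std_gauss_iter_cons.
- exact: measurable_std_gauss_iter_cons.
move=> x _.
exact: (IH _ _ _ _ mf' (fun p s => f0' p.1 (p.2 :: s)) (t, x) mg').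
Qed.

Lemma std_gauss_iterN t :
  std_gauss_iter m (fun s => f t (map -%R s)) = std_gauss_iter m (f t).
Proof.
elim: m d T f mf f0 t => [|k IH] d' T' f' //= mf' f0' t.
rewrite -[RHS]integral_normal_probN; last 2 first.
- exact: measurable_std_gauss_iter_cons.
- by move=> x; exact: std_gauss_iter_ge0.
apply: eq_integral => x _.
exact: (IH _ _ _ mf' (fun p s => f0' p.1 (p.2 :: s)) (t, - x)%R).
Qed.

End Linearity.

Lemma std_gauss_iter_sum m d (T : measurableType d) (I : Type) (r : seq I)
    (F : I -> T -> seq R -> \bar R) t :
  (forall i, seq_measurable m (F i)) -> (forall i t s, 0 <= F i t s) ->
  std_gauss_iter m (fun s => \sum_(i <- r) F i t s) =
  \sum_(i <- r) std_gauss_iter m (F i t).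
Proof.
move=> mF F0.
(* Additivity needs the partial sums to be measurable, so both facts are proved together. *)
suff [] : seq_measurable m (fun t s => \sum_(i <- r) F i t s) /\
    std_gauss_iter m (fun s => \sum_(i <- r) F i t s) =
    \sum_(i <- r) std_gauss_iter m (F i t) by [].
elim: r => [|i r [mr IH]].
  split.
    rewrite (_ : (fun t s => _) = (fun _ _ => 0)).
      by apply: seq_measurable_param; exact: measurable_cst.
    by apply/funext => t'; apply/funext => s; rewrite big_nil.
  by under eq_std_gauss_iter do rewrite big_nil; rewrite std_gauss_iter_cst big_nil.
split.
  rewrite (_ : (fun t s => _) = (fun t s => F i t s + \sum_(j <- r) F j t s)).
    apply: (@seq_measurable_op2 R _ _ _ (\bar R) (\bar R) (\bar R)
      (fun x y => x + y) _ _ _ _ _ _ (mF i) mr).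
    by move=> *; exact: emeasurable_funD.
  by apply/funext => t'; apply/funext => s; rewrite big_cons.
under eq_std_gauss_iter do rewrite big_cons.
rewrite (std_gauss_iterD (mF i) (F0 i) t mr) ?IH ?big_cons// => t' s.
by apply: sume_ge0 => j _.
Qed.

(** Keeps the distinguished variable last in the parameter when a further coordinate is absorbed. *)
Lemma measurable_swap_last d (T : measurableType d) : measurable_fun setT
  (fun q : (T * measurableTypeR R) * measurableTypeR R => ((q.1.1, q.2), q.1.2)).
Proof.
apply: measurable_fun_pair => /=.
  apply: measurable_fun_pair => //=; exact: measurableT_comp.
exact: measurableT_comp.
Qed.

Lemma seq_measurable_integral m d (T : measurableType d)
    (f : T * measurableTypeR R -> seq R -> \bar R) :
  seq_measurable m f -> (forall p s, 0 <= f p s) ->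
  seq_measurable m (fun t s => \int[N01]_x f (t, x) s).
Proof.
elim: m d T f => [|m IH] d T f /= mf f0.
  exact: (@measurable_fun_fubini_tonelli_F _ _ T (measurableTypeR R) R N01 _ mf).
exact: (IH _ _ _ (seq_measurable_precomp (@measurable_swap_last d T) mf)).
Qed.

(** The outermost integral is carried past the others one at a time, by one use of Tonelli per
    coordinate. *)
Lemma std_gauss_iter_tonelli m d (T : measurableType d)
    (f : T * measurableTypeR R -> seq R -> \bar R) t :
  seq_measurable m f -> (forall p s, 0 <= f p s) ->
  \int[N01]_x std_gauss_iter m (f (t, x)) =
  std_gauss_iter m (fun s => \int[N01]_x f (t, x) s).
Proof.
elim: m d T f t => [|m IH] d T f t //= mf f0.
have mf' := seq_measurable_precomp (@measurable_swap_last d T) mf.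
transitivity (\int[N01]_y \int[N01]_x std_gauss_iter m (fun s => f (t, x) (y :: s))).
  pose F (p : measurableTypeR R * measurableTypeR R) :=
    std_gauss_iter m (fun s => f (t, p.1) (p.2 :: s)).
  apply: (@fubini_tonelli _ _ _ _ R N01 N01 F) => [|p]; last exact: std_gauss_iter_ge0.
  have mt : measurable_fun setT (fun p : measurableTypeR R * measurableTypeR R =>
      ((t, p.1), p.2)).
    apply: measurable_fun_pair => //=; exact: measurable_fun_pair.
  apply: (measurable_std_gauss_iter (seq_measurable_precomp mt mf)).
  by move=> p s; exact: f0.
apply: eq_integral => y _.
exact: (IH _ _ _ (t, y) mf').
Qed.

End StdGaussIter.

(** * Gaussian matrices *)

Section LinearForms.
Context {R : realType}.
Implicit Types (a : nat -> R) (c : R).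

Definition linform m a (s : seq R) : R := \sum_(k < m) a k * nth 0 s k.

Lemma linform_cons m a x s :
  linform m.+1 a (x :: s) = a 0 * x + linform m (fun k => a k.+1) s.
Proof. by rewrite /linform big_ord_recl. Qed.

Lemma linformN m a s : linform m a (map -%R s) = - linform m a s.
Proof.
rewrite /linform -sumrN; apply: eq_bigr => k _; rewrite -mulrN; congr (_ * _).
have [ks|ks] := ltnP k (size s); first by rewrite (nth_map 0).
by rewrite !nth_default ?size_map ?oppr0.
Qed.

Lemma seq_measurable_linform m m' d (T : measurableType d) a :
  seq_measurable m (fun (t : T) s => linform m' a s).
Proof.
apply: seq_measurable_sum => k.
apply: (seq_measurable_comp (h := fun x : R => a k * x)); last exact: seq_measurable_nth.
exact: mulrl_measurable.
Qed.

Lemma seq_measurable_linform_comp m m' d (T : measurableType d) a (h : R -> R) :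
  measurable_fun setT h ->
  seq_measurable m (fun (t : T) s => (h (linform m' a s))%:E).
Proof.
move=> mh; apply: (seq_measurable_comp (h := fun x : R => (h x)%:E)).
  exact/measurable_EFinP.
exact: seq_measurable_linform.
Qed.

(** The shift [c] is there for the induction: once [x] is fixed, [a 0 * x] joins it. *)
Lemma std_gauss_iter_affine_sqr m c a :
  std_gauss_iter m (fun s => ((c + linform m a s) ^+ 2)%:E) =
  (c ^+ 2 + \sum_(k < m) a k ^+ 2)%:E.
Proof.
elim: m c a => [|m IH] c a /=; first by rewrite /linform !big_ord0 !addr0.
under eq_integral => x _.
  under eq_std_gauss_iter do rewrite linform_cons addrA.
  rewrite IH EFinD; over.
rewrite ge0_integralD//=; last 3 first.
- by move=> x _; rewrite lee_fin sqr_ge0.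
- apply/measurable_EFinP; apply: measurable_funX; exact: measurable_funD.
- by move=> x _; rewrite lee_fin sumr_ge0// => k _; rewrite sqr_ge0.
rewrite integral_normal_prob_affine_sqr integral_normal_prob_cst -EFinD.
by rewrite big_ord_recl addrA.
Qed.

Lemma std_gauss_iter_linform_sqr m a :
  std_gauss_iter m (fun s => (linform m a s ^+ 2)%:E) = (\sum_(k < m) a k ^+ 2)%:E.
Proof.
have := std_gauss_iter_affine_sqr m 0 a; rewrite expr0n add0r => <-.
by apply: eq_std_gauss_iter => s; rewrite add0r.
Qed.

Lemma measurable_sqr_lt (r : R) : measurable_fun setT (fun x : R => (x ^+ 2 < r)%R%:R : R).
Proof.
rewrite (_ : (fun x => _) = (fun x : R => if x ^+ 2 < r then 1 else 0)); last first.
  by apply/funext => x; case: ifP.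
apply: measurable_fun_ifT; [|exact: measurable_cst|exact: measurable_cst].
by apply: measurable_fun_ltr => //; exact: exprn_measurable.
Qed.

(* [z_k] is integrated first, the other coordinates being frozen. *)
Lemma std_gauss_iter_small m (k : nat) c a (r : R) : (k < m)%N -> a k != 0 -> 0 < r ->
  (std_gauss_iter m (fun s => ((c + linform m a s) ^+ 2 < r)%R%:R%:E) <=
   (normal_peak 1 * (2 * Num.sqrt r / `|a k|))%:E)%E.
Proof.
move=> + + r0; elim: m k c a => // m IH k c a km ak.
pose b i := a i.+1.
pose f (p : unit * measurableTypeR R) s : \bar R :=
  ((c + a 0 * p.2 + linform m b s) ^+ 2 < r)%R%:R%:E.
have f0 p s : (0 <= f p s)%E by rewrite lee_fin ler0n.
have mf : seq_measurable m f.
  apply: (@seq_measurable_comp _ _ _ R (\bar R) (fun y : R => (y ^+ 2 < r)%R%:R%:E)).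
    by apply/measurable_EFinP; exact: measurable_sqr_lt.
  apply: (@seq_measurable_op2 _ _ _ _ R R R (fun x y => x + y)).
  - by move=> *; exact: measurable_funD.
  - apply: seq_measurable_param; apply: measurable_funD => //.
    by apply: measurable_funM => //; exact: measurable_snd.
  - exact: seq_measurable_linform.
have -> : std_gauss_iter m.+1 (fun s => ((c + linform m.+1 a s) ^+ 2 < r)%R%:R%:E) =
    (\int[normal_prob 0 1]_x std_gauss_iter m (f (tt, x)))%E.
  apply: eq_integral => x _; apply: eq_std_gauss_iter => s.
  by rewrite /f linform_cons addrA.
case: k km ak => [|k] km ak.
  rewrite std_gauss_iter_tonelli//.
  rewrite -[leRHS](std_gauss_iter_cst m).
  apply: (@le_std_gauss_iter _ _ unit m (fun t s => \int[normal_prob 0 1]_x f (t, x) s)%E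
    (fun _ _ => _) _ _ tt).
  - exact: seq_measurable_integral.
  - by move=> t s; exact: integral_ge0.
  - by apply: seq_measurable_param; exact: measurable_cst.
  - move=> t s; rewrite -[leLHS]/(\int[_]_x _)%E /f /=.
    under eq_integral do rewrite addrAC.
    exact: normal_prob_small_affine.
(* For a later coordinate, the first one only changes the shift [c], on which the bound does not
   depend. *)
rewrite -[leRHS](integral_normal_prob_cst 0 1).
apply: ge0_le_integral => //=.
- by move=> x _; exact: std_gauss_iter_ge0.
- apply: (measurableT_comp (measurable_std_gauss_iter mf f0)).
  exact: pair1_measurable.
- by move=> x _; exact: IH.
Qed.

(** [y^2 = relu(y)^2 + relu(-y)^2], and the two terms have equal expectation under negation of all
    coordinates. *)
Lemma std_gauss_iter_relu_sqr m a :
  std_gauss_iter m (fun s => (relu (linform m a s) ^+ 2)%:E) =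
  ((\sum_(k < m) a k ^+ 2) / 2)%:E.
Proof.
have mrelu : measurable_fun setT (fun x : R => relu x ^+ 2).
  by apply: measurable_funX; exact: measurable_maxr.
have mreluN : measurable_fun setT (fun x : R => relu (- x) ^+ 2).
  by apply: measurable_funX; apply: measurable_maxr => //; exact: oppr_measurable.
have pos (h : seq R -> R) (s : seq R) : (0 <= (relu (h s) ^+ 2)%:E)%E by rewrite lee_fin sqr_ge0.
have sym := std_gauss_iterN (seq_measurable_linform_comp m m unit a mrelu)
  (fun _ => pos (linform m a)) tt.
have := std_gauss_iter_linform_sqr m a.
under eq_std_gauss_iter => s.
  rewrite (_ : linform m a s ^+ 2 =
    relu (linform m a s) ^+ 2 + relu (- linform m a s) ^+ 2); last first.
    rewrite /relu; set y := linform m a s; rewrite /Num.max.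
    by case: ltrgt0P => y0; case: ltP => ? //; rewrite ?sqrrN; nra.
  rewrite EFinD; over.
rewrite (@std_gauss_iterD _ _ unit m
  (fun _ s => (relu (linform m a s) ^+ 2)%:E)
  (fun _ s => (relu (- linform m a s) ^+ 2)%:E) _ _ tt)//; last 3 first.
- exact: (seq_measurable_linform_comp m m unit a mrelu).
- exact: (seq_measurable_linform_comp m m unit a mreluN).
- by move=> _; exact: (pos (fun s => - linform m a s)).
have -> : std_gauss_iter m (fun s => (relu (- linform m a s) ^+ 2)%:E) =
    std_gauss_iter m (fun s => (relu (linform m a s) ^+ 2)%:E).
  by rewrite -[RHS]sym; apply: eq_std_gauss_iter => s; rewrite linformN.
have : (0 <= std_gauss_iter m (fun s => (relu (linform m a s) ^+ 2)%:E))%E.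
  exact: std_gauss_iter_ge0.
case: std_gauss_iter => [r||]// _; rewrite -EFinD => -[<-].
by congr _%:E; lra.
Qed.

End LinearForms.

(** * Second moments of Gaussian matrices and the ReLU covariance *)

Section GaussianMatrix.
Context {R : realType}.

Definition gauss_fill n C (s : seq R) : 'M[R]_(n, C) :=
  \matrix_(i < n, j < C) nth 0 s (i + n * j).

(** The vector [b] placed in block [j] of the column-major flattening, zero elsewhere; with [b] a
    row of [B] it makes an entry of [B Z] a linear form in the flat list. *)
Definition col_coef n (b : 'I_n -> R) (j l : nat) : R :=
  \sum_(k < n) (l == k + n * j)%N%:R * b k.

Lemma gauss_index_lt n C (k : 'I_n) (j : 'I_C) : (k + n * j < n * C)%N.
Proof.
rewrite (@leq_trans (n * j.+1))//; first by rewrite mulnS ltn_add2r.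
by rewrite leq_mul2l ltn_ord orbT.
Qed.

Lemma sum_col_coef n C (b : 'I_n -> R) (j : 'I_C) (F : nat -> R) :
  \sum_(l < n * C) col_coef b j l * F l = \sum_k b k * F (k + n * j)%N.
Proof.
under eq_bigr do rewrite mulr_suml.
rewrite exchange_big/=; apply: eq_bigr => k _.
rewrite (bigD1 (Ordinal (gauss_index_lt k j)))//= eqxx mul1r big1 ?addr0// => l.
by rewrite -val_eqE /= => /negbTE ->; rewrite !mul0r.
Qed.

Lemma col_coefE n (b : 'I_n -> R) (j : nat) (k : 'I_n) :
  col_coef b j (k + n * j) = b k.
Proof.
rewrite /col_coef (bigD1 k)//= eqxx mul1r big1 ?addr0// => l lk.
by rewrite eqn_add2r eq_sym (_ : (l == k :> nat) = false) ?mul0r//; exact/negbTE.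
Qed.

Lemma sum_col_coef_sqr n C (b : 'I_n -> R) (j : 'I_C) :
  \sum_(l < n * C) col_coef b j l ^+ 2 = \sum_k b k ^+ 2.
Proof.
under eq_bigr do rewrite expr2.
rewrite (sum_col_coef b j (col_coef b j)); apply: eq_bigr => k _.
by rewrite col_coefE expr2.
Qed.

Lemma mulmx_gauss_fill m n C (B : 'M[R]_(m, n)) s (i : 'I_m) (j : 'I_C) :
  (B *m gauss_fill n C s) i j = linform (n * C) (col_coef (B i) j) s.
Proof.
rewrite mxE /linform (sum_col_coef (B i) j (nth 0 s)).
by apply: eq_bigr => k _; rewrite mxE.
Qed.

(** Each entry of [P H] is a linear form whose variance is the squared norm of a row of
    [P *m cov_factor S]; the [C] columns contribute equally. *)
Lemma gauss_mx_exp_frob2 n m C (S : 'M[R]_n) (P : 'M[R]_(m, n)) :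
  gauss_mx_exp (C := C) S (fun H => (frob2 (P *m H))%:E) =
  (C%:R * frob2 (P *m cov_factor S))%:E.
Proof.
set B := cov_factor S.
pose F (q : 'I_m * 'I_C) (_ : unit) s : \bar R :=
  (linform (n * C) (col_coef ((P *m B) q.1) q.2) s ^+ 2)%:E.
transitivity (std_gauss_iter (n * C) (fun s => \sum_q F q tt s)%E).
  apply: eq_std_gauss_iter => s; rewrite -/B -/(gauss_fill n C s) mulmxA.
  rewrite sumEFin /frob2 pair_big/=; congr _%:E; apply: eq_bigr => q _.
  by rewrite mulmx_gauss_fill.
rewrite (std_gauss_iter_sum _ tt) => [|q|q t s]; last 2 first.
- by apply: (@seq_measurable_linform_comp R _ _ _ unit _ (fun x => x ^+ 2)); exact: exprn_measurable.
- by rewrite lee_fin sqr_ge0.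
under eq_bigr do rewrite std_gauss_iter_linform_sqr sum_col_coef_sqr.
rewrite sumEFin; congr _%:E.
rewrite -(pair_big predT predT (fun i (j : 'I_C) => \sum_k (P *m B) i k ^+ 2))/=.
rewrite /frob2 mulr_sumr; apply: eq_bigr => i _.
by rewrite sumr_const card_ord mulr_natl.
Qed.

Lemma seq_measurable_frob2 n m C (P : 'M[R]_(m, n)) dT (T : measurableType dT) :
  seq_measurable (n * C) (fun (t : T) s => frob2 (P *m gauss_fill n C s)).
Proof.
apply: seq_measurable_sum => i; apply: seq_measurable_sum => j.
apply: (@seq_measurable_comp _ _ _ R R (fun x : R => x ^+ 2)).
  exact: exprn_measurable.
rewrite (_ : (fun t s => _) = fun (t : T) s => linform (n * C) (col_coef (P i) j) s).
  exact: seq_measurable_linform.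
by apply/funext => t; apply/funext => s; exact: mulmx_gauss_fill.
Qed.

Let reluform n (S : 'M[R]_n) (i : 'I_n) (s : seq R) : R :=
  relu (linform (n * 1) (col_coef (cov_factor S i) 0) s).

Lemma relu_ge0 (x : R) : 0 <= relu x.
Proof. by rewrite /relu le_max lexx orbT. Qed.

Let reluform_ge0 n (S : 'M[R]_n) i s : 0 <= reluform S i s.
Proof. exact: relu_ge0. Qed.

Let measurable_reluform n (S : 'M[R]_n) i j k dT (T : measurableType dT) :
  seq_measurable (n * 1) (fun (t : T) s => k * (reluform S i s * reluform S j s) : R).
Proof.
apply: (@seq_measurable_comp _ _ _ R R (fun x : R => k * x)).
  exact: mulrl_measurable.
have mr l : seq_measurable (n * 1) (fun (t : T) s => reluform S l s : R).
  apply: (@seq_measurable_comp _ _ _ R R relu); last exact: seq_measurable_linform.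
  exact: measurable_maxr.
apply: (@seq_measurable_op2 _ _ _ _ R R R (fun x y => x * y)) => //.
by move=> *; exact: measurable_funM.
Qed.

Let emeasurable_reluform n (S : 'M[R]_n) i j dT (T : measurableType dT) :
  seq_measurable (n * 1) (fun (t : T) s => (reluform S i s * reluform S j s)%:E).
Proof.
apply: (@seq_measurable_comp _ _ _ R (\bar R) EFin); first exact: EFin_measurable.
have := @measurable_reluform n S i j 1 _ T.
by under [X in seq_measurable _ X]eq_fun do under eq_fun do rewrite mul1r.
Qed.

(** [fine] in [Gmat] loses nothing: the product of two ReLUs is at most the sum of the squares,
    which has finite expectation. *)
Let Gmat_fin n (S : 'M[R]_n) i j :
  std_gauss_iter (n * 1) (fun s => (reluform S i s * reluform S j s)%:E) =
  (Gmat S i j)%:E.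
Proof.
rewrite mxE /gauss_mx_exp.
rewrite (@eq_std_gauss_iter _ _ _ (fun s => (reluform S i s * reluform S j s)%:E)); last first.
  by move=> s; rewrite -/(gauss_fill n 1 s) !mulmx_gauss_fill.
rewrite fineK// ge0_fin_numE; last first.
  by apply: std_gauss_iter_ge0 => s; rewrite lee_fin mulr_ge0.
pose c l := col_coef (cov_factor S l) 0.
have msq l : seq_measurable (n * 1) (fun (_ : unit) s => (linform (n * 1) (c l) s ^+ 2)%:E).
  by apply: (@seq_measurable_linform_comp R _ _ _ unit _ (fun x => x ^+ 2)); exact: exprn_measurable.
have sq0 l (t : unit) s : (0 <= (linform (n * 1) (c l) s ^+ 2)%:E)%E.
  by rewrite lee_fin sqr_ge0.
apply: (@le_lt_trans _ _ (std_gauss_iter (n * 1) (fun s =>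
  (linform (n * 1) (c i) s ^+ 2)%:E + (linform (n * 1) (c j) s ^+ 2)%:E)%E)).
  apply: (@le_std_gauss_iter _ _ unit _
    (fun _ s => (reluform S i s * reluform S j s)%:E)
    (fun _ s => (linform (n * 1) (c i) s ^+ 2)%:E + (linform (n * 1) (c j) s ^+ 2)%:E)%E
    _ _ tt).
  - exact: emeasurable_reluform.
  - by move=> t s; rewrite lee_fin mulr_ge0.
  - apply: (@seq_measurable_op2 _ _ _ _ (\bar R) (\bar R) (\bar R) (fun x y => x + y)%E) => //.
    by move=> *; exact: emeasurable_funD.
  - move=> t s; rewrite -EFinD lee_fin /reluform -/(c i) -/(c j) /relu.
    set x := linform _ _ s; set y := linform _ _ s.
    by have := sqr_ge0 (x - y); rewrite /Num.max; do 2!case: ifP => _; nra.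
rewrite (std_gauss_iterD (msq i) (sq0 i) tt (msq j) (sq0 j)).
by rewrite !std_gauss_iter_linform_sqr -EFinD ltry.
Qed.

Lemma trace_Gmat n (S : 'M[R]_n) : \tr (Gmat S) = frob2 (cov_factor S) / 2.
Proof.
rewrite /mxtrace /frob2 mulr_suml; apply: eq_bigr => i _.
have := Gmat_fin S i i.
rewrite (@eq_std_gauss_iter _ _ _ (fun s =>
  (relu (linform (n * 1) (col_coef (cov_factor S i) 0) s) ^+ 2)%:E)); last first.
  by move=> s; rewrite expr2.
rewrite std_gauss_iter_relu_sqr => -[<-]; congr (_ / 2).
exact: (sum_col_coef_sqr (cov_factor S i) (ord0 : 'I_1)).
Qed.

(* The form [x^T G x = E (sum_i x_i relu h_i)^2] is split according to the sign
   of [x_i x_j], so that only nonnegative functions are integrated. *)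
Lemma psd_Gmat n (S : 'M[R]_n) : psd (Gmat S).
Proof.
split=> [|x].
  apply/matrixP => i j; apply: EFin_inj; rewrite mxE -!Gmat_fin.
  by apply: eq_std_gauss_iter => s; rewrite mulrC.
pose w (q : 'I_n * 'I_n) := x q.1 0 * x q.2 0.
pose F (k : 'I_n * 'I_n -> R) q (_ : unit) s : \bar R :=
  (k q * (reluform S q.1 s * reluform S q.2 s))%:E.
have FE k : (forall q, 0 <= k q) ->
    std_gauss_iter (n * 1) (fun s => \sum_q F k q tt s)%E =
    (\sum_q k q * Gmat S q.1 q.2)%:E.
  move=> k0; rewrite (std_gauss_iter_sum _ tt) => [|q|q t s]; last 2 first.
  - apply: (@seq_measurable_comp _ _ _ R (\bar R) EFin); first exact: EFin_measurable.
    exact: measurable_reluform.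
  - by rewrite lee_fin !mulr_ge0.
  rewrite -sumEFin; apply: eq_bigr => q _; rewrite EFinM -Gmat_fin.
  under eq_std_gauss_iter do rewrite /F EFinM.
  apply: (@std_gauss_iterZl _ _ unit _ (fun _ s => (reluform S q.1 s * reluform S q.2 s)%:E)
    _ _ tt) => // t s.
  by rewrite lee_fin mulr_ge0.
pose wp q := Num.max (w q) 0; pose wn q := Num.max (- w q) 0.
have wp0 q : 0 <= wp q by rewrite le_max lexx orbT.
have wn0 q : 0 <= wn q by rewrite le_max lexx orbT.
have wE q : w q = wp q - wn q.
  by rewrite /wp /wn /Num.max; do 2!case: ifP; lra.
have mF k : seq_measurable (n * 1) (fun t s => \sum_q F k q t s)%E.
  rewrite (_ : (fun t s => _) = fun (t : unit) s =>
     (\sum_q k q * (reluform S q.1 s * reluform S q.2 s))%:E); last first.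
    by apply/funext => t; apply/funext => s; rewrite sumEFin.
  apply: (@seq_measurable_comp _ _ _ R (\bar R) EFin); first exact: EFin_measurable.
  by apply: seq_measurable_sum => q; exact: measurable_reluform.
have : ((\sum_q wn q * Gmat S q.1 q.2)%:E <= (\sum_q wp q * Gmat S q.1 q.2)%:E)%E.
  rewrite -!FE//.
  apply: (@le_std_gauss_iter _ _ unit _ (fun t s => \sum_q F wn q t s)%E
    (fun t s => \sum_q F wp q t s)%E (mF _) _ tt (mF _)) => t s.
    by apply: sume_ge0 => q _; rewrite lee_fin !mulr_ge0.
  rewrite !sumEFin lee_fin -subr_ge0 -sumrB.
  rewrite (eq_bigr (fun q => (x q.1 0 * reluform S q.1 s) * (x q.2 0 * reluform S q.2 s))).
    rewrite -(pair_big predT predT (fun i j => (x i 0 * reluform S i s) * (x j 0 * reluform S j s)))/=.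
    under eq_bigr do rewrite -mulr_sumr.
    by rewrite -mulr_suml -expr2 sqr_ge0.
  by move=> q _; rewrite -mulrBl -wE /w mulrACA.
rewrite lee_fin -subr_ge0 -sumrB => /le_trans; apply.
rewrite (eq_bigr (fun q => x q.1 0 * Gmat S q.1 q.2 * x q.2 0)); last first.
  by move=> q _; rewrite -mulrBl -wE /w mulrAC.
rewrite -(pair_big predT predT (fun i j => x i 0 * Gmat S i j * x j 0))/= exchange_big/=.
rewrite mxE; apply: ler_sum => j _; rewrite mxE mulr_suml; apply: ler_sum => i _.
by rewrite [x^T _ _]mxE.
Qed.

(** Positive semidefiniteness provides a factor, so [xget] does not fall back to its default 0. *)
Lemma cov_factorP n (S : 'M[R]_n) : psd S -> cov_factor S *m (cov_factor S)^T = S.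
Proof. by move=> /psd_factor; exact: (@xgetPex _ 0 [set B : 'M[R]_n | B *m B^T = S]). Qed.

End GaussianMatrix.

(** * The two metrics *)

Lemma cvg_to_EFin {R : realType} (z : nat -> R) (l : R) :
  z @ \oo --> l -> (fun L => (z L)%:E) @ \oo --> l%:E.
Proof. by move=> zl; apply: cvg_EFin => //; exact: nearW. Qed.

Section Metrics.
Context {R : realType}.
Variables (n d0 C : nat) (e : rel 'I_n) (X : 'M[R]_(n, d0)).
Hypotheses (e_sym : symmetric e) (X0 : X != 0).
Local Notation A := (Ahat e : 'M[R]_n).
Local Notation S := (Sigma e X).

Let n_gt0 : (0 < n)%N.
Proof. by have /matrix0Pn[i _] := X0; exact: leq_ltn_trans (ltn_ord i). Qed.

Let d0_gt0 : (0 < d0)%N.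
Proof. by have /matrix0Pn[_ [j _]] := X0; exact: leq_ltn_trans (ltn_ord j). Qed.

Let fX : 0 < frob2 X. Proof. exact: frob2_gt0. Qed.

Local Notation B sw2 L := (cov_factor (S sw2 L)).

Lemma SigmaS sw2 L : S sw2 L.+2 = sw2 *: (A *m Gmat (S sw2 L.+1) *m A).
Proof. by []. Qed.

Lemma psd_Sigma sw2 L : 0 <= sw2 -> psd (S sw2 L.+1).
Proof.
move=> sw0; case: L => [|L].
  have -> : S sw2 1 = (sw2 / d0%:R) *: ((A *m X) *m (A *m X)^T).
    by rewrite trmx_mul tr_Ahat// !mulmxA.
  by apply: psdZ (psd_mulmx_tr _); rewrite divr_ge0.
have [E EE] := psd_factor (psd_Gmat (S sw2 L.+1)).
have -> : S sw2 L.+2 = sw2 *: ((A *m E) *m (A *m E)^T).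
  by rewrite SigmaS -EE trmx_mul tr_Ahat// !mulmxA.
by apply: psdZ (psd_mulmx_tr _).
Qed.

Lemma frob2_cov_factor m (P : 'M[R]_(m, n)) (T : 'M[R]_n) : psd T ->
  frob2 (P *m cov_factor T) = \tr (P *m T *m P^T).
Proof.
move=> psdT; rewrite -{2}(cov_factorP psdT) -frob2_tr frob2E trmxK trmx_mul.
by rewrite !mulmxA.
Qed.

(** [E] factors [Gmat], so [sqrt sw2 A E] factors the next covariance. It may differ from the chosen
    [cov_factor], but both give the same [frob2 (P *m _)]. *)
Lemma Sigma_step sw2 L : 0 <= sw2 -> exists E : 'M[R]_n,
  frob2 E = frob2 (B sw2 L.+1) / 2 /\
  forall m (P : 'M[R]_(m, n)), frob2 (P *m B sw2 L.+2) = sw2 * frob2 (P *m (A *m E)).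
Proof.
move=> sw0; have [E EE] := psd_factor (psd_Gmat (S sw2 L.+1)).
exists E; split; first by rewrite -trace_Gmat -EE mxtrace_mulC -frob2E.
move=> m P; rewrite (frob2_cov_factor _ (psd_Sigma _ sw0)) SigmaS -EE.
rewrite -scalemxAr -scalemxAl mxtraceZ -[in RHS]frob2_tr frob2E trmxK.
by rewrite !trmx_mul tr_Ahat// !mulmxA.
Qed.

Lemma FSPE sw2 L : FSP e X C sw2 L = (C%:R * frob2 (B sw2 L) / frob2 X)%:E.
Proof.
pose r := (Num.sqrt (frob2 X))^-1.
have r2 : r ^+ 2 = (frob2 X)^-1 by rewrite exprVn sqr_sqrtr// ltW.
(* The division by [frob2 X] is absorbed into a scalar matrix [P]. *)
rewrite /FSP (_ : (fun H => _) = fun H : 'M[R]_(n, C) => (frob2 (r%:M *m H))%:E).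
  by rewrite gauss_mx_exp_frob2 mul_scalar_mx frob2Z r2; congr _%:E; ring.
by apply/funext => H; rewrite mul_scalar_mx frob2Z r2 mulrC.
Qed.

Lemma frob2_Sigma1 sw2 : 0 <= sw2 -> frob2 (B sw2 1) <= sw2 / d0%:R * frob2 X.
Proof.
move=> sw0.
have [P PE] := Lhat_factor e_sym (R := R).
have [AX _] := Ahat_gap e_sym X n_gt0 PE.
rewrite -(mul1mx (B _ _)) (frob2_cov_factor _ (psd_Sigma 0 sw0)) mul1mx trmx1 mulmx1.
have -> : S sw2 1 = (sw2 / d0%:R) *: ((A *m X) *m (A *m X)^T).
  by rewrite trmx_mul tr_Ahat// !mulmxA.
by rewrite mxtraceZ mxtrace_mulC -frob2E ler_wpM2l// divr_ge0.
Qed.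

Lemma frob2_SigmaS sw2 L : 0 <= sw2 ->
  frob2 (B sw2 L.+2) <= sw2 / 2 * frob2 (B sw2 L.+1).
Proof.
move=> sw0; have [E [fE EE]] := Sigma_step L sw0.
have [P PE] := Lhat_factor e_sym (R := R).
have [AE _] := Ahat_gap e_sym E n_gt0 PE.
rewrite -(mul1mx (B _ L.+2)) EE mul1mx mulrAC -mulrA -fE.
exact: ler_wpM2l.
Qed.

Lemma frob2_Sigma_le sw2 L : 0 <= sw2 ->
  frob2 (B sw2 L.+1) <= (2 / d0%:R) * (sw2 / 2) ^+ L.+1 * frob2 X.
Proof.
move=> sw0; elim: L => [|L IH].
  apply: (le_trans (frob2_Sigma1 sw0)); rewrite le_eqVlt; apply/orP; left; apply/eqP.
  by field; rewrite pnatr_eq0 -lt0n.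
apply: (le_trans (frob2_SigmaS L sw0)).
have s2 : 0 <= sw2 / 2 by rewrite divr_ge0.
apply: (le_trans (ler_wpM2l s2 IH)); rewrite le_eqVlt; apply/orP; left; apply/eqP.
by rewrite [in RHS]exprS; ring.
Qed.

Lemma FSP_le sw2 L : 0 <= sw2 -> (1 <= L)%N ->
  (FSP e X C sw2 L <= ((2 * C%:R / d0%:R) * (sw2 / 2) ^+ L)%:E)%E.
Proof.
case: L => // L sw0 _; rewrite FSPE lee_fin ler_pdivrMr//.
apply: (le_trans (ler_wpM2l (ler0n _ C) (frob2_Sigma_le L sw0))).
by rewrite le_eqVlt; apply/orP; left; apply/eqP; ring.
Qed.

(** At [sw2 = 2] the factor 2 cancels the 1/2 of the ReLU, so the loss in the propagation is exactly
    the difference of consecutive traces. *)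
Lemma frob2_decay_dirichlet (P : 'M[R]_n) L : Lhat e = P^T *m P ->
  frob2 (P *m B 2 L.+2) <=
    (5 * n.+1%:R) * (frob2 (B 2 L.+1) - frob2 (B 2 L.+2)).
Proof.
move=> PE; have [E [fE EE]] := @Sigma_step 2 L (ler0n _ _).
have [_ AE] := Ahat_gap e_sym E n_gt0 PE.
have := EE _ 1%:M; rewrite !mul1mx => fA.
rewrite EE fA; move: AE; rewrite fE.
have n0 : 0 <= n.+1%:R :> R by [].
lra.
Qed.

Lemma GEV_ge0 sw2 L : (0 <= GEV e X C sw2 L)%E.
Proof.
apply: std_gauss_iter_ge0 => s.
have [P PE] := Lhat_factor e_sym (R := R).
by rewrite lee_fin (dirichletE _ PE) divr_ge0 ?frob2_ge0.
Qed.

(** Pigeonhole over the [n^2] entries; the extra 2 leaves the contradiction [t <= t / 2]. *)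
Lemma cov_factor_entry_ge (T : 'M[R]_n) (t : R) : 0 < t -> t <= frob2 T ->
  exists i k, t / (2 * n%:R ^+ 2) <= T i k ^+ 2.
Proof.
move=> t0 tT; apply: contrapT => /forallNP small.
have n0 : 0 < n%:R :> R by rewrite ltr0n.
have : frob2 T <= \sum_(i < n) \sum_(k < n) t / (2 * n%:R ^+ 2).
  apply: ler_sum => i _; apply: ler_sum => k _.
  by have /forallNP/(_ k)/negP := small i; rewrite -ltNge => /ltW.
rewrite !sumr_const !card_ord -mulrnA -[leRHS]mulr_natr natrM.
have -> : t / (2 * n%:R ^+ 2) * (n%:R * n%:R) = t / 2 by field; rewrite gt_eqF.
lra.
Qed.

(* Where [H i j ^+ 2 >= r], the quotient is at most [dirichlet H / r];
   elsewhere it is at most [2]. *)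
Lemma GEV_le (P : 'M[R]_n) sw2 L (r t : R) :
  Lhat e = P^T *m P -> (1 <= C)%N -> 0 < r -> 0 < t -> t <= frob2 (B sw2 L) ->
  (GEV e X C sw2 L <=
    (2 * (normal_peak 1 * (2 * Num.sqrt r / Num.sqrt (t / (2 * n%:R ^+ 2))))
     + r^-1 * (C%:R * frob2 (P *m B sw2 L)))%:E)%E.
Proof.
move=> PE C1 r0 t0 tB; pose j : 'I_C := Ordinal C1.
have [i [k tau]] := cov_factor_entry_ge t0 tB.
set b := B sw2 L i k in tau.
have tau0 : 0 < t / (2 * n%:R ^+ 2).
  by rewrite divr_gt0// mulr_gt0// exprn_gt0// ltr0n.
have b_neq0 : b != 0.
  by rewrite -sqrf_eq0 gt_eqF// (lt_le_trans tau0 tau).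
have tau_b : Num.sqrt (t / (2 * n%:R ^+ 2)) <= `|b|.
  by rewrite -sqrtr_sqr ler_sqrt// sqr_ge0.
pose a := col_coef (B sw2 L i) j.
pose H s := B sw2 L *m gauss_fill n C s.
pose f (_ : unit) s : \bar R := (dirichlet e (H s) / frob2 (H s))%:E.
pose g1 (_ : unit) s : \bar R := ((0 + linform (n * C) a s) ^+ 2 < r)%R%:R%:E.
pose g2 (_ : unit) s : \bar R := (frob2 (P *m H s))%:E.
have g10 t' s : (0 <= g1 t' s)%E by rewrite lee_fin ler0n.
have g20 t' s : (0 <= g2 t' s)%E by rewrite lee_fin frob2_ge0.
have mg1 : seq_measurable (n * C) g1.
  apply: (@seq_measurable_linform_comp R _ _ _ unit _ (fun x => ((0 + x) ^+ 2 < r)%R%:R)).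
  under eq_fun do rewrite add0r.
  exact: measurable_sqr_lt.
have mfr m' (Q : 'M[R]_(m', n)) :
    seq_measurable (n * C) (fun (_ : unit) s => frob2 (Q *m H s)).
  rewrite (_ : (fun t s => _) =
    fun (_ : unit) s => frob2 ((Q *m B sw2 L) *m gauss_fill n C s)).
    exact: seq_measurable_frob2.
  by apply/funext => t'; apply/funext => s; rewrite /H mulmxA.
have mg2 : seq_measurable (n * C) g2.
  by apply: (@seq_measurable_comp _ _ _ R (\bar R) EFin); [exact: EFin_measurable|exact: mfr].
have mf : seq_measurable (n * C) f.
  apply: (@seq_measurable_comp _ _ _ R (\bar R) EFin); first exact: EFin_measurable.
  (* The inverse is written as a real power, which is measurable on the whole line and agrees with
     it on the nonnegative values of [frob2]. *)
  rewrite (_ : (fun t s => _) =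
      fun (_ : unit) s => frob2 (P *m H s) * (frob2 (1%:M *m H s)) `^ (-1)).
    apply: (@seq_measurable_op2 _ _ _ _ R R R (fun x y => x * y)) => //.
      by move=> *; exact: measurable_funM.
    by apply: (@seq_measurable_comp _ _ _ R R (fun x => x `^ (-1))).
  apply/funext => t'; apply/funext => s.
  by rewrite (dirichletE _ PE) mul1mx powR_inv1// frob2_ge0.
have f0 t' s : (0 <= f t' s)%E.
  by rewrite lee_fin (dirichletE _ PE) divr_ge0 ?frob2_ge0.
have fg t' s : (f t' s <= 2%:E * g1 t' s + r^-1%:E * g2 t' s)%E.
  rewrite -!EFinM -EFinD lee_fin add0r -(mulmx_gauss_fill (B sw2 L) s i j) -/(H s).
  rewrite -(dirichletE (H s) PE).
  have D0 : 0 <= dirichlet e (H s) by rewrite (dirichletE _ PE) frob2_ge0.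
  have [Hr|Hr] := ltP (H s i j ^+ 2) r.
    rewrite mulr1 (@le_trans _ _ 2)//; last by rewrite lerDl mulr_ge0// invr_ge0 ltW.
    (* At [H = 0] the quotient is 0 by the convention for the inverse. *)
    have [/eqP F0|F0] := eqVneq (frob2 (H s)) 0.
      by rewrite (eqP F0) invr0 mulr0.
    rewrite ler_pdivrMr ?dirichlet_le//.
    by rewrite lt_def F0 frob2_ge0.
  rewrite mulr0 add0r mulrC ler_wpM2r// lef_pV2 ?posrE//.
    exact: le_trans Hr (ge_frob2 _ _ _).
  exact: lt_le_trans r0 (le_trans Hr (ge_frob2 _ _ _)).
have mZ c (g : unit -> seq R -> \bar R) : seq_measurable (n * C) g ->
    seq_measurable (n * C) (fun t s => c%:E * g t s)%E.
  apply: (@seq_measurable_comp _ _ _ (\bar R) (\bar R) (fun x => c%:E * x)%E).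
  exact: measurable_funeM.
have g1Z0 t' s : (0 <= 2%:E * g1 t' s)%E by rewrite mule_ge0// lee_fin.
have r'0 : 0 <= r^-1 by rewrite invr_ge0 ltW.
have g2Z0 t' s : (0 <= r^-1%:E * g2 t' s)%E by rewrite mule_ge0.
have mg : seq_measurable (n * C) (fun t s => 2%:E * g1 t s + r^-1%:E * g2 t s)%E.
  apply: (@seq_measurable_op2 _ _ _ _ (\bar R) (\bar R) (\bar R) (fun x y => x + y)%E).
  - by move=> *; exact: emeasurable_funD.
  - exact: mZ.
  - exact: mZ.
apply: (le_trans (@le_std_gauss_iter _ _ unit _ f _ mf f0 tt mg fg)).
rewrite (std_gauss_iterD (mZ _ _ mg1) g1Z0 tt (mZ _ _ mg2) g2Z0).
rewrite (std_gauss_iterZl mg1 g10)// (std_gauss_iterZl mg2 g20)//.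
have -> : std_gauss_iter (n * C) (g2 tt) = (C%:R * frob2 (P *m B sw2 L))%:E.
  exact: gauss_mx_exp_frob2.
rewrite [in leRHS]EFinD -EFinM leeD2r// EFinM lee_wpmul2l//.
have kE : a (k + n * j)%N = b by rewrite /a col_coefE.
have := @std_gauss_iter_small R (n * C) (k + n * j) 0 a r (gauss_index_lt k j).
rewrite kE => /(_ b_neq0 r0) /le_trans; apply.
rewrite lee_fin ler_wpM2l ?normal_peak_ge0//.
rewrite ler_wpM2l ?mulr_ge0 ?sqrtr_ge0// lef_pV2// posrE ?normr_gt0//.
by rewrite sqrtr_gt0.
Qed.

Lemma GEV_or_FSP_cvg0 : (1 <= C)%N ->
  (fun L => GEV e X C 2 L) @ \oo --> 0%E \/
  (fun L => FSP e X C 2 L) @ \oo --> 0%E.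
Proof.
move=> C1; pose u L := frob2 (B 2 L.+1).
have uS L : u L.+1 <= u L.
  by have := frob2_SigmaS L (ler0n R 2); rewrite divff// mul1r.
have u0 L : 0 <= u L by exact: frob2_ge0.
have u_cvg : cvgn u.
  apply: nonincreasing_is_cvgn; first exact/nonincreasing_seqP.
  by exists 0 => _ [L _ <-].
have t_le L : limn u <= u L.
  by apply: nonincreasing_cvgn_ge => //; exact/nonincreasing_seqP.
have : 0 <= limn u by apply: limr_ge => //; exact: nearW.
rewrite le_eqVlt => /predU1P[t0|t0]; [right|left].
  rewrite -cvg_shiftS /=.
  under eq_fun do rewrite FSPE.
  apply: (cvg_to_EFin (z := fun L => C%:R * u L / frob2 X) (l := 0)).
  rewrite -[X in _ --> X](_ : C%:R * 0 / frob2 X = 0); last by rewrite mulr0 mul0r.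
  apply: cvgM; last exact: cvg_cst.
  by apply: cvgM; [exact: cvg_cst|rewrite t0].
have [P PE] := Lhat_factor e_sym (R := R).
(* The harmonic term keeps [v L] positive even when a layer loses no trace, so its square root is an
   admissible threshold. *)
pose v L := 5 * n.+1%:R * (u L - u L.+1) + harmonic L.
have v0 L : 0 < v L.
  by rewrite ltr_wpDl ?harmonic_gt0// mulr_ge0// subr_ge0.
have v_cvg : v @ \oo --> (0 : R).
  rewrite -[X in _ --> X](_ : 5 * n.+1%:R * (limn u - limn u) + 0 = 0); last first.
    by rewrite subrr mulr0 addr0.
  apply: cvgD; last exact: cvg_harmonic.
  apply: cvgM; first exact: cvg_cst.
  by apply: cvgB => //; rewrite (cvg_shiftS u).
pose tau := Num.sqrt (limn u / (2 * n%:R ^+ 2)).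
(* [GEV_le] at [r = sqrt (v L)]: the energy is at most [v L], so dividing it by [r] leaves
   [sqrt (v L)]. *)
pose w L := 2 * (normal_peak 1 * (2 * Num.sqrt (Num.sqrt (v L)) / tau))
  + C%:R * Num.sqrt (v L).
have GEV_w L : (GEV e X C 2 L.+2 <= (w L)%:E)%E.
  have sv0 : 0 < Num.sqrt (v L) by rewrite sqrtr_gt0.
  apply: (le_trans (GEV_le PE C1 sv0 t0 (t_le L.+1))).
  rewrite lee_fin lerD2l mulrCA ler_wpM2l// mulrC ler_pdivrMr// -expr2.
  rewrite sqr_sqrtr; last exact: ltW.
  apply: (le_trans (frob2_decay_dirichlet L PE)).
  by rewrite lerDl ltW// harmonic_gt0.
have w_cvg : w @ \oo --> (0 : R).
  have sqrt_cvg (z : nat -> R) : z @ \oo --> (0 : R) ->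
      (fun L => Num.sqrt (z L)) @ \oo --> (0 : R).
    move=> z0; rewrite -[X in _ --> X](@sqrtr0 R).
    exact: (cvg_comp _ _ z0 (@sqrt_continuous R 0)).
  have sv := sqrt_cvg _ v_cvg.
  have ssv := sqrt_cvg _ sv.
  rewrite -[X in _ --> X](_ : 2 * (normal_peak 1 * (2 * 0 / tau)) + C%:R * 0 = 0); last first.
    by rewrite !(mulr0, mul0r) addr0.
  apply: cvgD; last by apply: cvgM => //; exact: cvg_cst.
  apply: cvgM; first exact: cvg_cst.
  apply: cvgM; first exact: cvg_cst.
  apply: cvgM; last exact: cvg_cst.
  by apply: cvgM => //; exact: cvg_cst.
rewrite -cvg_shiftS -cvg_shiftS /=.
have bounds : \forall L \near \oo, (0 <= GEV e X C 2 L.+2 <= (w L)%:E)%E.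
  by apply: nearW => L; rewrite GEV_ge0 GEV_w.
exact: (squeeze_cvge bounds (cvg_cst _) (cvg_to_EFin w_cvg)).
Qed.

End Metrics.

Theorem theorem1 (R : realType) (n d0 C : nat) (e : rel 'I_n)
  (X : 'M[R]_(n, d0)) :
  symmetric e -> irreflexive e -> X != 0 -> (1 <= C)%N ->
  ((fun L => GEV e X C 2 L) @ \oo --> 0%E \/
   (fun L => FSP e X C 2 L) @ \oo --> 0%E) /\
  (forall sw2 : R, 0 < sw2 < 2 -> forall L : nat, (1 <= L)%N ->
     (FSP e X C sw2 L <= ((2 * C%:R / d0%:R) * (sw2 / 2) ^+ L)%:E)%E).
Proof.
move=> e_sym _ X0 C1; split; first exact: GEV_or_FSP_cvg0.
by move=> sw2 /andP[/ltW sw0 _] L; exact: FSP_le.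
Qed.
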